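(* Let $k\ge2$ and let $P(\lambda)=\sum_{i=0}^{k}A_i\lambda^i$, $A_i\in\mathbb{C}^{n\times n}$, be a regular matrix polynomial of degree $k$ with $A_0\ne0$. Assume that $\delta$ is a simple, finite, nonzero eigenvalue of $P(\lambda)$. Let $t\in\{1,k\}$ and suppose that $A_0$ is nonsingular if $t=1$, and $A_k$ is nonsingular if $t=k$. Let $$\rho:=\frac{\max_{i=0,\ldots,k}\{\|A_i\|_2\}}{\min\{\|A_k\|_2,\|A_0\|_2\}}.$$ Then, if either $t=1$ and $|\delta|\ge1$, or $t=k$ and $|\delta|\le1$, we have $$\frac1\rho\le\frac{\kappa_{D_t}(\delta)}{\kappa_P(\delta)}\le k^2\rho.$$
   Context: $\|\cdot\|_2$ is the Euclidean norm of vectors and the spectral norm of matrices. $P$ has degree $k$ if $A_k\neq0$, and is regular if $\det P(\lambda)$ is not identically zero. Condition number. For a regular matrix polynomial $Q(\lambda)=\sum_{i=0}^{d}B_i\lambda^i$ of degree $d$ (in particular for a pencil $Q(\lambda)=\lambda L_1-L_0$) and a simple, finite, nonzero eigenvalue $\delta$ with right eigenvector $x$, the relative normwise condition number with natural weights is $$\kappa_Q(\delta)=\lim_{\epsilon\to0}\sup\Big\{\tfrac{|\Delta\delta|}{\epsilon|\delta|}:[Q(\delta+\Delta\delta)+\Delta Q(\delta+\Delta\delta)](x+\Delta x)=0,\ \|\Delta B_i\|_2\le\epsilon\|B_i\|_2,\ i=0,\ldots,d\Big\},$$ where $\Delta Q(\lambda)=\sum_i\lambda^i\Delta B_i$. It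 is known that, for any right and left eigenvectors $x,y$ associated with $\delta$ (i.e. nonzero vectors with $Q(\delta)x=0$, $y^*Q(\delta)=0$), $$\kappa_Q(\delta)=\frac{\left(\sum_{i=0}^{d}|\delta|^i\|B_i\|_2\right)\|y\|_2\|x\|_2}{|\delta|\,|y^*Q'(\delta)x|}.$$ The pencils $D_1,D_k$. $D_1(\lambda,P)=\lambda L_1-L_0$ is the $k\times k$ block pencil ($n\times n$ blocks) where $L_1$ has block $(1,1)$ equal to $A_k$, blocks $(1,j)$ and $(j,1)$, $j\ge2$, equal to $0$, and for $2\le i,j\le k$ block $(i,j)$ equal to $-A_{k+2-i-j}$ if $i+j\le k+2$ and $0$ otherwise; $L_0$ has block $(i,j)$ equal to $-A_{k+1-i-j}$ if $i+j\le k+1$ and $0$ otherwise. $D_k(\lambda,P)=\lambda L_1-L_0$ is the $k\times k$ block pencil where $L_1$ has block $(i,j)$ equal to $A_{2k+1-i-j}$ if $i+j\ge k+1$ and $0$ otherwise; $L_0$ has, for $1\le i,j\le k-1$, block $(i,j)$ equal to $A_{2k-i-j}$ if $i+j\ge k$ and $0$ otherwise, block $(k,k)$ equal to $-A_0$, and the remaining blocks of block-row and block-column $k$ equal to $0$. $\kappa_{D_t}$ denotes the condition number for the pencil $D_t(\lambda,P)$. For regular $P$ it is known that $D_1(\lambda,P)$ (resp. $D_k(\lambda,P)$) is a linearization of $P$ if and only if $A_0$ (resp. $A_k$) is nonsingular. *)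

(* Defs.v *)
From HB Require Import structures.
From mathcomp Require Import all_boot all_order all_algebra.
From mathcomp Require Import complex.
From mathcomp Require Import all_classical all_reals all_analysis.

Set Implicit Arguments.
Unset Strict Implicit.
Unset Printing Implicit Defensive.

Import Order.TTheory GRing.Theory Num.Theory.
Import numFieldNormedType.Exports.
Import ComplexField.

Local Open Scope classical_set_scope.
Local Open Scope complex_scope.
Local Open Scope ring_scope.

(* A matrix polynomial of grade d is given by a family B : nat -> 'M_m of which
   only B 0, ..., B d matter. Moduli of complex numbers are taken with
   Normc.normc, which is R-valued, unlike `|z| : R[i]. *)

Definition vnorm2 (R : realType) (m : nat) (v : 'cV[R[i]]_m) : R :=
  Num.sqrt (\sum_(i < m) Normc.normc (v i 0) ^+ 2).

Definition specnorm (R : realType) (m : nat) (M : 'M[R[i]]_m) : R :=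
  sup [set vnorm2 (M *m v) | v in [set v : 'cV[R[i]]_m | vnorm2 v <= 1]].

Definition mxeval (R : realType) (m d : nat) (B : nat -> 'M[R[i]]_m)
    (z : R[i]) : 'M[R[i]]_m :=
  \sum_(i < d.+1) z ^+ i *: B i.

Definition mxpoly_det (R : realType) (m d : nat) (B : nat -> 'M[R[i]]_m) :
    {poly R[i]} :=
  \det (\sum_(i < d.+1) 'X^i *: map_mx polyC (B i)).

Definition regular_mxpoly (R : realType) (m d : nat)
    (B : nat -> 'M[R[i]]_m) : Prop :=
  mxpoly_det d B != 0.

Definition simple_eigenvalue (R : realType) (m d : nat)
    (B : nat -> 'M[R[i]]_m) (delta : R[i]) : Prop :=
  mup delta (mxpoly_det d B) = 1%N.

Definition right_eigenvector (R : realType) (m d : nat)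
    (B : nat -> 'M[R[i]]_m) (delta : R[i]) (x : 'cV[R[i]]_m) : Prop :=
  x != 0 /\ mxeval d B delta *m x = 0.

Definition cond_quotients (R : realType) (m d : nat) (B : nat -> 'M[R[i]]_m)
    (delta : R[i]) (x : 'cV[R[i]]_m) (r eps : R) : set (\bar R) :=
  [set q | exists (dB : nat -> 'M[R[i]]_m) (ddelta : R[i]) (dx : 'cV[R[i]]_m),
    [/\ (mxeval d B (delta + ddelta) + mxeval d dB (delta + ddelta))
          *m (x + dx) = 0,
        forall i : nat, (i <= d)%N -> specnorm (dB i) <= eps * specnorm (B i),
        Normc.normc ddelta <= r,
        vnorm2 dx <= r
      & q = (Normc.normc ddelta / (eps * Normc.normc delta))%:E]].

(* The perturbations of the eigenpair are understood to be small: without the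
   bounds by r, dx = - x makes every ddelta admissible, and other eigenvalues
   of B also contribute, so that the supremum is always +oo or blows up as
   eps tends to 0. Hence the limit eps -> 0 is taken with (ddelta, dx) confined
   to a ball of radius r, and then r -> 0. *)
Definition cond_number (R : realType) (m d : nat) (B : nat -> 'M[R[i]]_m)
    (delta : R[i]) (x : 'cV[R[i]]_m) : \bar R :=
  lim ((lim (ereal_sup (cond_quotients d B delta x r eps)
               @[eps --> (0 : R)^'+])) @[r --> (0 : R)^'+]).

(* The coefficients of the pencil z *: L1 - L0, as a polynomial of degree 1. *)
Definition pencil (R : realType) (m : nat) (L1 L0 : 'M[R[i]]_m) (i : nat) :
    'M[R[i]]_m :=
  if i == 0%N then - L0 else L1.

(* [block_matrix k F] has block F i j in position (i, j), with block indices
   i, j running from 1 to k. *)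
Definition block_matrix (R : realType) (n k : nat)
    (F : nat -> nat -> 'M[R[i]]_n) : 'M[R[i]]_(\sum_(i < k) n) :=
  \mxblock_(i < k, j < k) F i.+1 j.+1.

Definition D1_L1 (R : realType) (n k : nat) (A : nat -> 'M[R[i]]_n) :=
  block_matrix k (fun i j : nat =>
    if (i == 1%N) && (j == 1%N) then A k
    else if (i == 1%N) || (j == 1%N) then 0
    else if (i + j <= k + 2)%N then - A (k + 2 - i - j)%N else 0).

Definition D1_L0 (R : realType) (n k : nat) (A : nat -> 'M[R[i]]_n) :=
  block_matrix k (fun i j : nat =>
    if (i + j <= k + 1)%N then - A (k + 1 - i - j)%N else 0).

Definition Dk_L1 (R : realType) (n k : nat) (A : nat -> 'M[R[i]]_n) :=
  block_matrix k (fun i j : nat =>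
    if (k + 1 <= i + j)%N then A (2 * k + 1 - i - j)%N else 0).

Definition Dk_L0 (R : realType) (n k : nat) (A : nat -> 'M[R[i]]_n) :=
  block_matrix k (fun i j : nat =>
    if (i == k) && (j == k) then - A 0%N
    else if (i == k) || (j == k) then 0
    else if (k <= i + j)%N then A (2 * k - i - j)%N else 0).

Definition D1 (R : realType) (n k : nat) (A : nat -> 'M[R[i]]_n) :=
  pencil (D1_L1 k A) (D1_L0 k A).

Definition Dk (R : realType) (n k : nat) (A : nat -> 'M[R[i]]_n) :=
  pencil (Dk_L1 k A) (Dk_L0 k A).

(* Meaningful only for t = 1 and t = k. *)
Definition D (R : realType) (n k t : nat) (A : nat -> 'M[R[i]]_n) :=
  if t == 1%N then D1 k A else Dk k A.

Definition rho (R : realType) (n k : nat) (A : nat -> 'M[R[i]]_n) : R :=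
  (\big[Num.max/0]_(i < k.+1) specnorm (A i))
    / Num.min (specnorm (A k)) (specnorm (A 0%N)).

(* Main.v *)
(* Let Q be a matrix polynomial with a simple eigenvalue delta, and let H be a
   matrix function, continuous at delta, with Q(l) H(l) = (l - delta) I near
   delta; H(delta) then has rank one and its range is spanned by the right
   eigenvector. Put s(l) = sum |l|^i ||B_i||. If (l, v) is an eigenpair of
   Q + dQ, then (l - delta) v = - H(l) dQ(l) v, hence
   |l - delta| <= eps s(l) ||H(l)||; conversely, a rank one perturbation makes
   any l on a ray from delta an eigenvalue at this cost, up to o(eps). So the
   condition number is s(delta) ||H(delta)|| / |delta|, and eigenvector
   normalizations never enter.

   For P one takes H = adj P / g with det P = (l - delta) g. For D_t, write
   Lam = (l^(k-1), ..., l, 1)^T. The identity D_t (Lam (x) I) = e_t (x) P shows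
   that D_t(l) can be inverted explicitly in terms of P(l), up to the matrix W
   obtained from D_t by replacing its last block column by e_t (x) I; W is
   invertible when A_0 (t = 1) or A_k (t = k) is. At delta this gives
   H_D = delta^(t-k) (Lam (x) I) H_P (Lam^T (x) I), so that
   ||H_D|| = |delta|^(t-k) ||Lam||^2 ||H_P||. The ratio of the condition numbers
   is therefore an explicit expression in the norms of the coefficients, to be
   bounded with a geometric sum. *)
Require Import Defs.
From mathcomp Require Import all_boot all_order all_algebra.
From mathcomp Require Import complex.
From mathcomp Require Import all_classical all_reals all_analysis.
From mathcomp Require Import ring lra zify.

Set Implicit Arguments.
Unset Strict Implicit.
Unset Printing Implicit Defensive.

Import Order.TTheory GRing.Theory Num.Theory.
Import numFieldNormedType.Exports.
Import ComplexField.

Local Open Scope classical_set_scope.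
Local Open Scope complex_scope.
Local Open Scope ring_scope.

Local Notation normc := Normc.normc.

(** * Euclidean and spectral norms *)

Section EuclideanNorm.
Variable R : realType.
Implicit Types (a c : R[i]) (m p : nat).

Lemma normc_ge0 a : 0 <= normc a.
Proof. by case: a => *; exact: sqrtr_ge0. Qed.

Lemma complex_normE a : `|a| = (normc a)%:C.
Proof. by []. Qed.

Lemma normcX a n : normc (a ^+ n) = normc a ^+ n.
Proof.
elim: n => [|n IH]; first by rewrite !expr0 Normc.normc1.
by rewrite !exprS Normc.normcM IH.
Qed.

Lemma normc_real (b : R) : normc b%:C = `|b|.
Proof. by rewrite /normc /= expr0n addr0 sqrtr_sqr. Qed.

Lemma normc_conj a : normc a^* = normc a.
Proof. by case: a => b c /=; rewrite sqrrN. Qed.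

Lemma mul_conjc a : a * a^* = (normc a ^+ 2)%:C.
Proof. by rewrite -sqr_normc complex_normE -rmorphXn. Qed.

Lemma normc_eq0 a : (normc a == 0) = (a == 0).
Proof.
by apply/eqP/eqP => [/Normc.eq0_normc //|->]; rewrite Normc.normc0.
Qed.

Lemma normc_gt0 a : (0 < normc a) = (a != 0).
Proof. by rewrite lt_neqAle normc_ge0 andbT eq_sym normc_eq0. Qed.

Lemma ler_normc_sum (I : Type) (r : seq I) (P : pred I) (F : I -> R[i]) :
  normc (\sum_(i <- r | P i) F i) <= \sum_(i <- r | P i) normc (F i).
Proof.
elim/big_rec2: _ => [|i y1 y2 _ h]; first by rewrite Normc.normc0.
by apply: le_trans (le_normcD _ _) _; rewrite lerD2l.
Qed.

(** Lagrange's identity: the double sum of $(a_i b_j - a_j b_i)^2$ is twice the difference between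
    $\sum a_i^2 \sum b_j^2$ and $(\sum a_i b_i)^2$. *)
Lemma CauchySchwarz_sum (I : finType) (a b : I -> R) :
  \sum_i a i * b i
    <= Num.sqrt (\sum_i a i ^+ 2) * Num.sqrt (\sum_i b i ^+ 2).
Proof.
have s0 (c : I -> R) : 0 <= \sum_i c i ^+ 2 by apply: sumr_ge0 => i _; exact: sqr_ge0.
apply: le_trans (ler_norm _) _.
rewrite -sqrtrM // -sqrtr_sqr ler_wsqrtr //.
have : 0 <= \sum_i \sum_j (a i * b j - a j * b i) ^+ 2.
  by do 2!(apply: sumr_ge0 => ? _); exact: sqr_ge0.
have dist (f g : I -> R) : \sum_i \sum_j (f i * g j) = (\sum_i f i) * (\sum_j g j).
  by rewrite mulr_suml; apply: eq_bigr => i _; rewrite mulr_sumr.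
have -> : \sum_i \sum_j (a i * b j - a j * b i) ^+ 2
   = (\sum_i a i ^+ 2) * (\sum_i b i ^+ 2) *+ 2 - (\sum_i a i * b i) ^+ 2 *+ 2.
  transitivity (\sum_i \sum_j a i ^+ 2 * b j ^+ 2
     + \sum_i \sum_j b i ^+ 2 * a j ^+ 2
     + \sum_i \sum_j (- 2 * (a i * b i)) * (a j * b j)).
    rewrite -!big_split /=; apply: eq_bigr => i _.
    rewrite -!big_split /=; apply: eq_bigr => j _.
    ring.
  by rewrite !dist -mulr_sumr; ring.
by rewrite subr_ge0 lerMn2r.
Qed.

Lemma vnorm2_ge0 m (v : 'cV[R[i]]_m) : 0 <= vnorm2 v.
Proof. exact: sqrtr_ge0. Qed.

Lemma vnorm2_sqr m (v : 'cV[R[i]]_m) :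
  vnorm2 v ^+ 2 = \sum_(i < m) normc (v i 0) ^+ 2.
Proof. by rewrite sqr_sqrtr // sumr_ge0 // => i _; exact: sqr_ge0. Qed.

Lemma vnorm2_eq0 m (v : 'cV[R[i]]_m) : (vnorm2 v == 0) = (v == 0).
Proof.
apply/idP/eqP => [|->]; last first.
  rewrite /vnorm2 big1 ?sqrtr0 // => i _.
  by rewrite mxE Normc.normc0 expr0n.
rewrite -[vnorm2 v == 0](@expf_eq0 _ _ 2) vnorm2_sqr psumr_eq0; last by move=> i _; exact: sqr_ge0.
move=> /allP h; apply/matrixP => i j; rewrite ord1 mxE.
by have := h i (mem_index_enum _); rewrite expf_eq0 /= normc_eq0 => /eqP.
Qed.

Lemma vnorm20 m : vnorm2 (0 : 'cV[R[i]]_m) = 0.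
Proof. by apply/eqP; rewrite vnorm2_eq0. Qed.

Lemma vnorm2_gt0 m (v : 'cV[R[i]]_m) : (0 < vnorm2 v) = (v != 0).
Proof. by rewrite lt_neqAle vnorm2_ge0 andbT eq_sym vnorm2_eq0. Qed.

Lemma vnorm2Z m a (v : 'cV[R[i]]_m) : vnorm2 (a *: v) = normc a * vnorm2 v.
Proof.
rewrite /vnorm2; under eq_bigr do rewrite mxE Normc.normcM exprMn.
rewrite -mulr_sumr sqrtrM ?sqr_ge0 // sqrtr_sqr ger0_norm //; exact: normc_ge0.
Qed.

Lemma vnorm2N m (v : 'cV[R[i]]_m) : vnorm2 (- v) = vnorm2 v.
Proof. by rewrite -scaleN1r vnorm2Z normcN Normc.normc1 mul1r. Qed.

Lemma vnorm2_dot m (u v : 'I_m -> R[i]) :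
  normc (\sum_i u i * v i) <= vnorm2 (\col_i u i) * vnorm2 (\col_i v i).
Proof.
apply: le_trans (ler_normc_sum _ _ _) _.
under eq_bigr do rewrite Normc.normcM.
apply: le_trans (CauchySchwarz_sum _ _) _.
by rewrite /vnorm2; under [X in _ <= Num.sqrt X * _]eq_bigr do rewrite mxE;
  under [X in _ <= _ * Num.sqrt X]eq_bigr do rewrite mxE.
Qed.

Lemma ler_vnorm2D m (u v : 'cV[R[i]]_m) : vnorm2 (u + v) <= vnorm2 u + vnorm2 v.
Proof.
rewrite -(@ler_pXn2r _ 2) // ?nnegrE ?addr_ge0 ?vnorm2_ge0 //.
rewrite sqrrD !vnorm2_sqr.
have h : \sum_i normc (u i 0) * normc (v i 0) <= vnorm2 u * vnorm2 v.
  exact: CauchySchwarz_sum.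
apply: (@le_trans _ _ (\sum_i normc (u i 0) ^+ 2
  + (\sum_i normc (u i 0) * normc (v i 0)) *+ 2 + \sum_i normc (v i 0) ^+ 2)).
  rewrite -sumrMnl -!big_split /=; apply: ler_sum => i _.
  rewrite mxE -sqrrD ler_pXn2r ?nnegrE ?addr_ge0 ?normc_ge0 //.
  exact: le_normcD.
by rewrite lerD2r lerD2l lerMn2r.
Qed.

Lemma ler_vnorm2_sum m (I : Type) (r : seq I) (P : pred I) (F : I -> 'cV[R[i]]_m) :
  vnorm2 (\sum_(i <- r | P i) F i) <= \sum_(i <- r | P i) vnorm2 (F i).
Proof.
elim/big_rec2: _ => [|i y1 y2 _ h]; first by rewrite vnorm20.
by apply: le_trans (ler_vnorm2D _ _) _; rewrite lerD2l.
Qed.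

Lemma ler_normc_vnorm2 m (v : 'cV[R[i]]_m) i : normc (v i 0) <= vnorm2 v.
Proof.
rewrite -(@ler_pXn2r _ 2) // ?nnegrE ?normc_ge0 ?vnorm2_ge0 //.
rewrite vnorm2_sqr (bigD1 i) //= lerDl sumr_ge0 // => j _; exact: sqr_ge0.
Qed.

Lemma ler_vnorm2_sum_normc m (v : 'cV[R[i]]_m) :
  vnorm2 v <= \sum_i normc (v i 0).
Proof.
have e : v = \sum_i (v i 0 *: delta_mx i 0).
  by rewrite [LHS]matrix_sum_delta; apply: eq_bigr => i _; rewrite big_ord1.
rewrite {1}e.
apply: le_trans (ler_vnorm2_sum _ _ _) _; apply: ler_sum => i _.
rewrite vnorm2Z ler_piMr ?normc_ge0 //.
rewrite /vnorm2 (bigD1 i) //= mxE !eqxx Normc.normc1 expr1n big1 ?addr0 ?sqrtr1 //.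
by move=> j /negPf ji; rewrite mxE ji Normc.normc0 expr0n.
Qed.

End EuclideanNorm.

Section SpectralNorm.
Variable R : realType.
Implicit Types (a c : R[i]) (m p : nat).

(** A crude bound with two uses: it makes the supremum in [specnorm] finite, and it reduces
    continuity in the spectral norm to continuity of the entries. *)
Lemma vnorm2_mul_entries m (M : 'M[R[i]]_m) (v : 'cV[R[i]]_m) :
  vnorm2 (M *m v) <= (\sum_i \sum_j normc (M i j)) * vnorm2 v.
Proof.
apply: le_trans (ler_vnorm2_sum_normc _) _.
rewrite mulr_suml; apply: ler_sum => i _.
rewrite mxE; apply: le_trans (ler_normc_sum _ _ _) _.
rewrite mulr_suml; apply: ler_sum => j _.
by rewrite Normc.normcM ler_wpM2l ?normc_ge0 // ler_normc_vnorm2.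
Qed.

Let unit_images m (M : 'M[R[i]]_m) :=
  [set vnorm2 (M *m v) | v in [set v : 'cV[R[i]]_m | vnorm2 v <= 1]].

Lemma specnorm_has_sup m (M : 'M[R[i]]_m) : has_sup (unit_images M).
Proof.
split; first by exists (vnorm2 (M *m 0)), 0 => //=; rewrite vnorm20.
exists (\sum_i \sum_j normc (M i j)) => _ [v /= v1 <-].
apply: le_trans (vnorm2_mul_entries _ _) _.
rewrite ler_piMr // sumr_ge0 // => i _; rewrite sumr_ge0 // => j _.
exact: normc_ge0.
Qed.

Lemma specnorm_ge0 m (M : 'M[R[i]]_m) : 0 <= specnorm M.
Proof.
apply: (@ub_le_sup _ (unit_images M)); first by case: (specnorm_has_sup M).
by exists 0 => /=; rewrite ?mulmx0 vnorm20.
Qed.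

Lemma vnorm2_mul m (M : 'M[R[i]]_m) (v : 'cV[R[i]]_m) :
  vnorm2 (M *m v) <= specnorm M * vnorm2 v.
Proof.
have [->|v0] := eqVneq v 0; first by rewrite mulmx0 vnorm20 mulr0.
rewrite -ler_pdivrMr ?vnorm2_gt0 //.
apply: (@ub_le_sup _ (unit_images M)); first by case: (specnorm_has_sup M).
exists ((vnorm2 v)^-1%:C *: v) => /=.
  rewrite vnorm2Z normc_real ger0_norm ?invr_ge0 ?vnorm2_ge0 // mulVf //.
  by rewrite vnorm2_eq0.
rewrite -scalemxAr vnorm2Z normc_real ger0_norm ?invr_ge0 ?vnorm2_ge0 //.
by rewrite mulrC.
Qed.

Lemma specnorm_le m (M : 'M[R[i]]_m) (b : R) :
  0 <= b -> (forall v, vnorm2 (M *m v) <= b * vnorm2 v) -> specnorm M <= b.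
Proof.
move=> b0 h; apply: sup_le_ub.
  by exists (vnorm2 (M *m 0)), 0 => //=; rewrite vnorm20.
by move=> _ [v /= v1 <-]; apply: le_trans (h v) _; rewrite ler_piMr.
Qed.

Lemma specnorm_entries m (M : 'M[R[i]]_m) :
  specnorm M <= \sum_i \sum_j normc (M i j).
Proof.
apply: specnorm_le; last exact: vnorm2_mul_entries.
by do 2!(apply: sumr_ge0 => ? _); exact: normc_ge0.
Qed.

Lemma specnorm_adherent m (M : 'M[R[i]]_m) (b : R) :
  b < specnorm M -> exists2 u, vnorm2 u <= 1 & b < vnorm2 (M *m u).
Proof.
move=> hb.
have [] := @sup_adherent _ (unit_images M) (specnorm M - b) _ (specnorm_has_sup M).
  by rewrite subr_gt0.
move=> _ [u /= u1 <-]; rewrite -/(specnorm M) opprB addrC subrK => h.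
by exists u.
Qed.

Lemma specnorm_eq0 m (M : 'M[R[i]]_m) : (specnorm M == 0) = (M == 0).
Proof.
apply/eqP/eqP => [h|->]; last first.
  apply/eqP; rewrite eq_le specnorm_ge0 andbT specnorm_le // => v.
  by rewrite mul0mx vnorm20 mul0r.
apply/matrixP => i j.
have : M *m delta_mx j 0 == 0 :> 'cV_m.
  by rewrite -vnorm2_eq0 eq_le vnorm2_ge0 andbT -(mul0r (vnorm2 (delta_mx j 0))) -h vnorm2_mul.
by rewrite -colE => /eqP/matrixP/(_ i 0); rewrite !mxE.
Qed.

Lemma specnorm_gt0 m (M : 'M[R[i]]_m) : (0 < specnorm M) = (M != 0).
Proof. by rewrite lt_neqAle specnorm_ge0 andbT eq_sym specnorm_eq0. Qed.

Lemma specnormZ m a (M : 'M[R[i]]_m) : specnorm (a *: M) = normc a * specnorm M.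
Proof.
have le c (N : 'M[R[i]]_m) : specnorm (c *: N) <= normc c * specnorm N.
  apply: specnorm_le; first by rewrite mulr_ge0 ?normc_ge0 ?specnorm_ge0.
  by move=> v; rewrite -scalemxAl vnorm2Z -mulrA ler_wpM2l ?normc_ge0 // vnorm2_mul.
apply/eqP; rewrite eq_le le /=.
have [->|a0] := eqVneq a 0; first by rewrite Normc.normc0 mul0r specnorm_ge0.
(* The reverse inequality is the one just proved, applied to [a^-1] and [a *: M]. *)
have := le a^-1 (a *: M).
by rewrite scalerA mulVf // scale1r Normc.normcV mulrC ler_pdivlMr ?normc_gt0 // mulrC.
Qed.

Lemma specnormN m (M : 'M[R[i]]_m) : specnorm (- M) = specnorm M.
Proof. by rewrite -scaleN1r specnormZ normcN Normc.normc1 mul1r. Qed.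

(** The matrix is $u w^*$; it sends $v$ to the multiple $w^* v$ of $u$, and Cauchy-Schwarz bounds
    this scalar. *)
Lemma specnorm_outer m (u w : 'cV[R[i]]_m) :
  specnorm (u *m map_mx conjc w^T) <= vnorm2 u * vnorm2 w.
Proof.
apply: specnorm_le; first by rewrite mulr_ge0 ?vnorm2_ge0.
move=> v; rewrite -mulmxA [X in u *m X]mx11_scalar mul_mx_scalar vnorm2Z mulrC -mulrA.
apply: ler_wpM2l; first exact: vnorm2_ge0.
rewrite mxE; apply: le_trans (vnorm2_dot _ _) _.
have -> : \col_i (v i 0) = v by apply/matrixP => i j; rewrite mxE ord1.
apply: ler_wpM2r; first exact: vnorm2_ge0.
rewrite le_eqVlt; apply/orP; left; apply/eqP.
by rewrite /vnorm2; under eq_bigr do rewrite !mxE normc_conj.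
Qed.

Lemma outer_self m (u w : 'cV[R[i]]_m) :
  u *m map_mx conjc w^T *m w = (vnorm2 w ^+ 2)%:C *: u.
Proof.
rewrite -mulmxA [X in u *m X]mx11_scalar mul_mx_scalar; congr (_ *: _).
rewrite mxE vnorm2_sqr rmorph_sum /=; apply: eq_bigr => i _.
by rewrite !mxE mulrC mul_conjc.
Qed.

End SpectralNorm.

(* Otherwise unification compares suprema when a lemma does not match. *)
#[global] Opaque specnorm vnorm2.

(** * Continuity at a complex point *)

Section ComplexNeighborhoods.
Variable R : realType.
Implicit Types (a c d l : R[i]) (m p : nat).

(* [R[i]] itself is not equipped with the topology of a [numFieldType], hence
   this explicit filter. *)
Definition cnbhs d : set_system R[i] :=
  filter_from [set r : R | 0 < r] (fun r => [set l | normc (l - d) <= r]).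

Global Instance cnbhs_filter d : ProperFilter (cnbhs d).
Proof.
apply: filter_from_proper; last first.
  by move=> r /= r0; exists d => /=; rewrite subrr Normc.normc0 ltW.
apply: filter_from_filter; first by exists 1 => /=; exact: ltr01.
move=> r s /= r0 s0; exists (Num.min r s); first by rewrite /= lt_min r0.
by move=> l /=; rewrite le_min => /andP.
Qed.

Lemma cvg_dominated (T : Type) (F : set_system T) {FF : Filter F} (g h : T -> R) (b : R) :
  (forall t, `|g t - b| <= h t) -> h t @[t --> F] --> (0 : R) -> g t @[t --> F] --> b.
Proof.
move=> gh h0; apply/cvgrPdist_le => e e0.
apply: filterS (cvgr0_norm_lt _ h0 _ e0) => t ht; rewrite distrC; apply: le_trans (gh t) _.
by apply: le_trans (ler_norm _) (ltW ht).
Qed.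

Lemma cvg_sumr (T : Type) (F : set_system T) {FF : Filter F} (I : Type)
    (r : seq I) (f : I -> T -> R) (b : I -> R) :
  (forall i, f i t @[t --> F] --> b i) ->
  \sum_(i <- r) f i t @[t --> F] --> \sum_(i <- r) b i.
Proof.
move=> h.
exact: (@cvg_big _ _ +%R 0 xpredT add_continuous _ F r f b FF (fun i _ => h i)).
Qed.

(** Continuity at [d], phrased through a real-valued function so that all limits are taken in
    [R]. *)
Definition ccont (f : R[i] -> R[i]) d :=
  normc (f l - f d) @[l --> cnbhs d] --> (0 : R).

Lemma ler_dist_normc a c : `|normc a - normc c| <= normc (a - c).
Proof.
have h a' c' : normc a' - normc c' <= normc (a' - c').
  by rewrite lerBlDr; apply: le_trans (le_normcD _ _); rewrite subrK.
by rewrite ler_norml h andbT lerNl opprB -(normcN (a - c)) opprB.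
Qed.

Lemma ccont_normc f d : ccont f d -> normc (f l) @[l --> cnbhs d] --> normc (f d).
Proof. by move=> cf; apply: (cvg_dominated _ cf) => l; exact: ler_dist_normc. Qed.

Lemma ccont_cst c d : ccont (fun=> c) d.
Proof. by rewrite /ccont subrr Normc.normc0; exact: cvg_cst. Qed.

Lemma ccont_id d : ccont id d.
Proof.
apply/cvgrPdist_le => e e0; exists e => //= l h.
by rewrite sub0r normrN ger0_norm ?normc_ge0.
Qed.

Lemma ccontD f g d : ccont f d -> ccont g d -> ccont (fun l => f l + g l) d.
Proof.
move=> cf cg; apply: (@cvg_dominated _ _ _ _
  (fun l => normc (f l - f d) + normc (g l - g d))); last first.
  by rewrite -[0]addr0; exact: cvgD.
move=> l; rewrite subr0 ger0_norm ?normc_ge0 //.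
by rewrite opprD addrACA; exact: le_normcD.
Qed.

Lemma ccontM f g d : ccont f d -> ccont g d -> ccont (fun l => f l * g l) d.
Proof.
move=> cf cg; apply: (@cvg_dominated _ _ _ _
  (fun l => normc (f l - f d) * normc (g l) + normc (f d) * normc (g l - g d))); last first.
  have -> : (0 : R) = 0 * normc (g d) + normc (f d) * 0 by rewrite mul0r mulr0 addr0.
  by apply: cvgD; apply: cvgM => //; [exact: ccont_normc|exact: cvg_cst].
move=> l; rewrite subr0 ger0_norm ?normc_ge0 // -!Normc.normcM.
have -> : f l * g l - f d * g d = (f l - f d) * g l + f d * (g l - g d) by ring.
exact: le_normcD.
Qed.

Lemma ccont_near_neq0 f d : ccont f d -> f d != 0 -> \forall l \near cnbhs d, f l != 0.
Proof.
move=> cf; rewrite -normc_gt0 => fd0.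
by apply: filterS (cvgr_gt _ (ccont_normc cf) _ fd0) => l; rewrite normc_gt0.
Qed.

Lemma ccontV f d : ccont f d -> f d != 0 -> ccont (fun l => (f l)^-1) d.
Proof.
move=> cf fd0; have nf := ccont_near_neq0 cf fd0.
have : (normc (f l - f d) * (normc (f l))^-1 * (normc (f d))^-1)
    @[l --> cnbhs d] --> 0 * (normc (f d))^-1 * (normc (f d))^-1.
  apply: cvgM; last exact: cvg_cst.
  by apply: cvgM => //; apply: cvgV; [rewrite normc_eq0|exact: ccont_normc].
rewrite !mul0r => h; apply/cvgrPdist_le => e e0.
near=> l; have fl0 : f l != 0 by near: l.
have hl : `|normc (f l - f d) / normc (f l) / normc (f d)| < e.
  by near: l; exact: cvgr0_norm_lt h _ e0.
rewrite sub0r normrN.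
apply: ltW; apply: le_lt_trans hl; rewrite ger0_norm ?normc_ge0 //.
rewrite -!Normc.normcV -!Normc.normcM.
have -> : (f l)^-1 - (f d)^-1 = - ((f l - f d) / f l / f d).
  by field; rewrite fl0 fd0.
by rewrite normcN ler_norm.
Unshelve. all: by end_near. Qed.

Lemma ccont_sum (I : Type) (r : seq I) (P : pred I) (F : I -> R[i] -> R[i]) d :
  (forall i, P i -> ccont (F i) d) -> ccont (fun l => \sum_(i <- r | P i) F i l) d.
Proof.
move=> h; elim: r => [|j r IH].
  have -> : (fun l => \sum_(i <- [::] | P i) F i l) = (fun=> 0).
    by apply/funext => l; rewrite big_nil.
  exact: ccont_cst.
have -> : (fun l => \sum_(i <- j :: r | P i) F i l)
  = (fun l => (if P j then F j l else 0) + \sum_(i <- r | P i) F i l).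
  by apply/funext => l; rewrite big_cons; case: (P j) => //; rewrite add0r.
apply: ccontD => //; case: (P j) (h j) => [/(_ isT) //|_]; exact: ccont_cst.
Qed.

Lemma ccont_horner (p : {poly R[i]}) d : ccont (horner p) d.
Proof.
elim/poly_ind: p => [|p c IH].
  have -> : horner (0 : {poly R[i]}) = (fun=> 0) by apply/funext => l; rewrite horner0.
  exact: ccont_cst.
have -> : horner (p * 'X + c%:P) = (fun l => p.[l] * l + c).
  by apply/funext => l; rewrite hornerMXaddC.
by apply: ccontD; [apply: ccontM => //; exact: ccont_id|exact: ccont_cst].
Qed.

Definition mcont m p (M : R[i] -> 'M[R[i]]_(m, p)) d :=
  forall i j, ccont (fun l => M l i j) d.

Lemma mcont_cst m p (M : 'M[R[i]]_(m, p)) d : mcont (fun=> M) d.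
Proof. by move=> i j; exact: ccont_cst. Qed.

Lemma mcontM m p q (M : R[i] -> 'M[R[i]]_(m, p)) (N : R[i] -> 'M[R[i]]_(p, q)) d :
  mcont M d -> mcont N d -> mcont (fun l => M l *m N l) d.
Proof.
move=> cM cN i j.
have -> : (fun l => (M l *m N l) i j) = (fun l => \sum_k M l i k * N l k j).
  by apply/funext => l; rewrite mxE.
by apply: ccont_sum => k _; exact: ccontM.
Qed.

Lemma mcontZ m p (f : R[i] -> R[i]) (M : R[i] -> 'M[R[i]]_(m, p)) d :
  ccont f d -> mcont M d -> mcont (fun l => f l *: M l) d.
Proof.
move=> cf cM i j.
have -> : (fun l => (f l *: M l) i j) = (fun l => f l * M l i j).
  by apply/funext => l; rewrite mxE.
exact: ccontM.
Qed.

Lemma mcont_horner m p (M : 'M[{poly R[i]}]_(m, p)) d :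
  mcont (fun l => map_mx (horner_eval l) M) d.
Proof.
move=> i j.
have -> : (fun l => map_mx (horner_eval l) M i j) = horner (M i j).
  by apply/funext => l; rewrite mxE.
exact: ccont_horner.
Qed.

Lemma specnormD m (M N : 'M[R[i]]_m) : specnorm (M + N) <= specnorm M + specnorm N.
Proof.
apply: specnorm_le => [|v]; first by rewrite addr_ge0 ?specnorm_ge0.
rewrite mulmxDl mulrDl; apply: le_trans (ler_vnorm2D _ _) _.
by apply: lerD; exact: vnorm2_mul.
Qed.

Lemma mcont_specnormB m (M : R[i] -> 'M[R[i]]_m) d :
  mcont M d -> specnorm (M l - M d) @[l --> cnbhs d] --> (0 : R).
Proof.
move=> cM; apply: (@cvg_dominated _ _ _ _
  (fun l => \sum_i \sum_j normc (M l i j - M d i j))) => [l|].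
  rewrite subr0 ger0_norm ?specnorm_ge0 //.
  apply: le_trans (specnorm_entries _) _.
  by rewrite le_eqVlt; apply/orP; left; apply/eqP; do 2!(apply: eq_bigr => ? _); rewrite !mxE.
have h i := @cvg_sumr _ _ (cnbhs_filter d) _ (index_enum 'I_m) _ _ (cM i).
have := @cvg_sumr _ _ (cnbhs_filter d) _ (index_enum 'I_m) _ _ h.
by rewrite big1 // => i _; rewrite big1.
Qed.

Lemma mcont_specnorm m (M : R[i] -> 'M[R[i]]_m) d :
  mcont M d -> specnorm (M l) @[l --> cnbhs d] --> specnorm (M d).
Proof.
move=> /mcont_specnormB cM; apply: (cvg_dominated _ cM) => l.
have h (A B : 'M[R[i]]_m) : specnorm A - specnorm B <= specnorm (A - B).
  by rewrite lerBlDr; apply: le_trans (specnormD _ _); rewrite subrK.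
by rewrite ler_norml h andbT lerNl opprB -(specnormN (M l - M d)) opprB.
Qed.

Lemma mcont_vnorm2B m (M : R[i] -> 'M[R[i]]_m) (u : 'cV[R[i]]_m) d :
  mcont M d -> vnorm2 (M l *m u - M d *m u) @[l --> cnbhs d] --> (0 : R).
Proof.
move=> cM; apply: (@cvg_dominated _ _ _ _
  (fun l => specnorm (M l - M d) * vnorm2 u)) => [l|].
  by rewrite subr0 ger0_norm ?vnorm2_ge0 // -mulmxBl vnorm2_mul.
by rewrite -[0 in X in _ --> X](mul0r (vnorm2 u)); apply: cvgM;
  [exact: mcont_specnormB|exact: cvg_cst].
Qed.

Lemma mcont_vnorm2 m (M : R[i] -> 'M[R[i]]_m) (u : 'cV[R[i]]_m) d :
  mcont M d -> vnorm2 (M l *m u) @[l --> cnbhs d] --> vnorm2 (M d *m u).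
Proof.
move=> /(@mcont_vnorm2B _ _ u) cM; apply: (cvg_dominated _ cM) => l.
have h (a b : 'cV[R[i]]_m) : vnorm2 a - vnorm2 b <= vnorm2 (a - b).
  by rewrite lerBlDr; apply: le_trans (ler_vnorm2D _ _); rewrite subrK.
by rewrite ler_norml h andbT lerNl opprB -(vnorm2N (M l *m u - M d *m u)) opprB.
Qed.

End ComplexNeighborhoods.

(** * Condition number from the resolvent *)

Section ConditionNumber.
Variables (R : realType) (m d : nat) (B : nat -> 'M[R[i]]_m).
Implicit Types (l delta : R[i]) (u v x : 'cV[R[i]]_m) (H : 'M[R[i]]_m).

(** The weight $s(l)$ of the overview: it bounds the norm at $l$ of every perturbation admissible
    for [eps = 1]. *)
Definition wsum l : R := \sum_(i < d.+1) normc l ^+ i * specnorm (B i).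

Lemma wsum_ge0 l : 0 <= wsum l.
Proof.
by apply: sumr_ge0 => i _; rewrite mulr_ge0 ?specnorm_ge0 // exprn_ge0 ?normc_ge0.
Qed.

Lemma cvg_wsum l : wsum t @[t --> cnbhs l] --> wsum l.
Proof.
have h (i : 'I_d.+1) : normc t ^+ i * specnorm (B i) @[t --> cnbhs l]
    --> normc l ^+ i * specnorm (B i).
  apply: cvgM; last exact: cvg_cst.
  rewrite -normcX; under eq_cvg do rewrite -normcX.
  apply: (@ccont_normc _ (fun t => t ^+ i)).
  have -> : (fun t : R[i] => t ^+ i) = horner 'X^i by apply/funext => t; rewrite hornerXn.
  exact: ccont_horner.
exact: (@cvg_sumr _ _ _ (cnbhs_filter l) _ (index_enum 'I_d.+1) _ _ h).
Qed.

Lemma mxeval_perturb_le (dB : nat -> 'M[R[i]]_m) (eps : R) l v :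
  (forall i, (i <= d)%N -> specnorm (dB i) <= eps * specnorm (B i)) ->
  vnorm2 (mxeval d dB l *m v) <= eps * wsum l * vnorm2 v.
Proof.
move=> h; rewrite /mxeval mulmx_suml.
apply: le_trans (ler_vnorm2_sum _ _ _) _.
rewrite mulr_sumr mulr_suml; apply: ler_sum => i _.
rewrite -scalemxAl vnorm2Z normcX mulrCA -!mulrA.
apply: ler_wpM2l; first by rewrite exprn_ge0 ?normc_ge0.
rewrite mulrA; apply: le_trans (vnorm2_mul _ _) _.
apply: ler_wpM2r; first exact: vnorm2_ge0.
by apply: h; rewrite -ltnS.
Qed.

(** A one-sided inverse of a square matrix is two-sided. This turns $Q(l)H(l) = (l-\delta)I$ into
    $H(l)Q(l) = (l-\delta)I$ for $l \ne \delta$. *)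
Lemma mulmx_scalarC (M N : 'M[R[i]]_m) (a : R[i]) :
  a != 0 -> M *m N = a%:M -> N *m M = a%:M.
Proof.
move=> a0 h.
have /mulmx1C : M *m (a^-1 *: N) = 1%:M.
  by rewrite -scalemxAr h -mul_scalar_mx -scalar_mxM mulVf.
by rewrite -scalemxAl => /(congr1 (fun X => a *: X)); rewrite scalerA mulfV // scale1r scalemx1.
Qed.

Lemma eigenvalue_shift_le (dB : nat -> 'M[R[i]]_m) (eps : R) delta l H v :
  (forall i, (i <= d)%N -> specnorm (dB i) <= eps * specnorm (B i)) ->
  mxeval d B l *m H = (l - delta)%:M -> v != 0 -> 0 <= eps ->
  (mxeval d B l + mxeval d dB l) *m v = 0 ->
  normc (l - delta) <= eps * (wsum l * specnorm H).
Proof.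
move=> hdB hH v0 eps0 hv.
(* Commuting [H] with $Q(l)$ requires $l \ne \delta$; otherwise the left-hand side is zero. *)
have [->|ld] := eqVneq (l - delta) 0.
  by rewrite Normc.normc0 !mulr_ge0 ?wsum_ge0 ?specnorm_ge0.
have hH' := mulmx_scalarC ld hH.
rewrite -(ler_pM2r (x := vnorm2 v)) ?vnorm2_gt0 // -vnorm2Z.
have -> : (l - delta) *: v = - (H *m (mxeval d dB l *m v)).
  rewrite -mul_scalar_mx -hH' -mulmxA -mulmxN; congr (_ *m _).
  by apply/eqP; rewrite -addr_eq0 -mulmxDl hv.
rewrite vnorm2N; apply: le_trans (vnorm2_mul _ _) _.
have -> : eps * (wsum l * specnorm H) * vnorm2 v = specnorm H * (eps * wsum l * vnorm2 v) by ring.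
by apply: ler_wpM2l; [exact: specnorm_ge0|exact: mxeval_perturb_le].
Qed.

(* The rank one matrix [E] that sends [w] to [- (l - delta) u] makes
   [Q(l) + E] singular; it is split among the coefficients in proportion to
   their norms, with phases such that the pieces add up again at [l]. *)
Lemma eigenvalue_shift_attained (eps : R) delta l H u :
  let w := H *m u in
  mxeval d B l *m H = (l - delta)%:M -> vnorm2 u <= 1 -> w != 0 -> 0 < wsum l ->
  normc (l - delta) <= eps * (wsum l * vnorm2 w) ->
  exists2 dB : nat -> 'M[R[i]]_m,
    forall i, (i <= d)%N -> specnorm (dB i) <= eps * specnorm (B i) &
    (mxeval d B l + mxeval d dB l) *m w = 0.
Proof.
move=> w hH u1 w0 s0 hl.
have nw0 : 0 < vnorm2 w by rewrite vnorm2_gt0.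
pose E := (- ((l - delta) / (vnorm2 w ^+ 2)%:C)) *: (u *m map_mx conjc w^T).
have hE : specnorm E <= eps * wsum l.
  rewrite specnormZ normcN Normc.normcM Normc.normcV normc_real ger0_norm ?exprn_ge0 ?vnorm2_ge0 //.
  apply: (@le_trans _ _ (normc (l - delta) / vnorm2 w ^+ 2 * (1 * vnorm2 w))).
    apply: ler_wpM2l; first by rewrite mulr_ge0 ?normc_ge0 // invr_ge0 exprn_ge0 ?vnorm2_ge0.
    apply: le_trans (specnorm_outer _ _) _.
    by apply: ler_wpM2r => //; exact: ltW.
  have -> : normc (l - delta) / vnorm2 w ^+ 2 * (1 * vnorm2 w) = normc (l - delta) / vnorm2 w.
    by field; rewrite gt_eqF.
  by rewrite ler_pdivrMr // -mulrA.
have hEw : E *m w = - ((l - delta) *: u).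
  rewrite /E -scalemxAl outer_self scalerA mulNr divfK ?scaleNr //.
  by rewrite -normc_eq0 normc_real normr_eq0 expf_eq0 /= gt_eqF.
(* The conjugate phase of $l^i$. Since division by zero gives zero, [c i] is 0 when $l = 0$ and $i >
   0$; both $|c_i| \le 1$ and $l^i c_i = |l|^i$ remain true. *)
pose c i : R[i] := (l ^+ i)^* / (normc l ^+ i)%:C.
have c1 i : normc (c i) <= 1.
  rewrite Normc.normcM Normc.normcV normc_conj normcX normc_real ger0_norm ?exprn_ge0 ?normc_ge0 //.
  by have [->|?] := eqVneq (normc l ^+ i) 0; rewrite ?mul0r ?ler01 // mulfV.
have hc i : l ^+ i * c i = (normc l ^+ i)%:C.
  rewrite /c mulrA mul_conjc normcX expr2 rmorphM /=.
  have [->|n0] := eqVneq (normc l ^+ i) 0; first by rewrite !mul0r.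
  by rewrite mulfK // -normc_eq0 normc_real normr_eq0.
exists (fun i => (c i * (specnorm (B i) / wsum l)%:C) *: E).
  move=> i _; rewrite specnormZ Normc.normcM normc_real.
  have q0 := divr_ge0 (specnorm_ge0 (B i)) (wsum_ge0 l).
  rewrite (ger0_norm q0).
  apply: (@le_trans _ _ (1 * (specnorm (B i) / wsum l) * (eps * wsum l))).
    apply: ler_pM => //; first by apply: mulr_ge0 q0; exact: normc_ge0.
      exact: specnorm_ge0.
    by apply: ler_wpM2r q0 _ _ _.
  by rewrite le_eqVlt; apply/orP; left; apply/eqP; field; rewrite gt_eqF.
rewrite mulmxDl /w mulmxA hH mul_scalar_mx -/w.
suff -> : mxeval d (fun i => (c i * (specnorm (B i) / wsum l)%:C) *: E) l = E.
  by rewrite hEw subrr.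
(* At $l$ the piece of index $i$ becomes $|l|^i \|B_i\| / s(l)$ times [E], and these weights sum to
   1. *)
rewrite /mxeval; under eq_bigr do rewrite scalerA mulrA hc -rmorphM /= mulrA.
rewrite -scaler_suml -rmorph_sum /= -mulr_suml -/(wsum l) mulfV ?gt_eqF //.
by rewrite scale1r.
Qed.

(** Values squeezed between two reals are finite, so the convergence can be checked on their real
    values. *)
Lemma cvg_ereal_close (T : Type) (F : set_system T) {FF : Filter F} (f : T -> \bar R) (b : R) :
  (forall e, 0 < e -> \forall t \near F, ((b - e)%:E <= f t <= (b + e)%:E)%E) ->
  f t @[t --> F] --> b%:E.
Proof.
move=> h.
have fin (e : R) (y : \bar R) : ((b - e)%:E <= y <= (b + e)%:E)%E ->
    y \is a fin_num /\ `|b - fine y| <= e.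
  case: y => [y||] /=; rewrite ?leey ?leNye ?andbF //.
  rewrite !lee_fin => /andP[h1 h2]; split => //.
  by rewrite ler_norml; apply/andP; split; lra.
apply/fine_cvgP; split.
  by apply: filterS (h 1 ltr01) => t /fin[].
apply/cvgrPdist_le => e e0.
by apply: filterS (h e e0) => t /fin[].
Qed.

Variables (delta : R[i]) (x : 'cV[R[i]]_m) (H : R[i] -> 'M[R[i]]_m).
Hypotheses (delta0 : delta != 0) (x0 : x != 0) (Hcont : mcont H delta)
  (QH : \forall l \near cnbhs delta, mxeval d B l *m H l = (l - delta)%:M)
  (Hrange : forall u, exists a, H delta *m u = a *: x)
  (H0 : H delta != 0) (s0 : 0 < wsum delta).

(** Divided by $|\delta|$, this is the value to be established for the condition number. *)
Let K := wsum delta * specnorm (H delta).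

Let K0 : 0 < K.
Proof. by rewrite mulr_gt0 // specnorm_gt0. Qed.

Let nd0 : 0 < normc delta.
Proof. by rewrite normc_gt0. Qed.

Let cvgK : wsum l * specnorm (H l) @[l --> cnbhs delta] --> K.
Proof. by apply: cvgM; [exact: cvg_wsum|exact: mcont_specnorm]. Qed.

Let near_cnbhs (P : R[i] -> Prop) : (\forall l \near cnbhs delta, P l) ->
  exists2 r, 0 < r & forall l, normc (l - delta) <= r -> P l.
Proof. by case=> r /= r0 h; exists r => // l; exact: h. Qed.

(** A bootstrap. The crude bound $K+1$, valid for $|l-\delta| \le r$, forces $|\Delta\delta| \le
    \epsilon(K+1)$; for small $\epsilon$ the perturbed eigenvalue is then so close to $\delta$ that
    the same estimate holds with $K + e|\delta|$ in place of $K+1$. *)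
Lemma cond_quotients_le r e : 0 < r -> r < vnorm2 x ->
  (forall l, normc (l - delta) <= r -> mxeval d B l *m H l = (l - delta)%:M
     /\ wsum l * specnorm (H l) <= K + 1) ->
  0 < e -> \forall eps \near (0 : R)^'+,
    (ereal_sup (cond_quotients d B delta x r eps) <= (K / normc delta + e)%:E)%E.
Proof.
move=> r0 rx hr e0.
have : \forall l \near cnbhs delta, wsum l * specnorm (H l) < K + e * normc delta.
  by apply: (cvgr_lt _ cvgK); rewrite ltrDl mulr_gt0.
move=> /near_cnbhs[r2 r20 hr2].
have K1 : 0 < K + 1 by rewrite addr_gt0.
near=> eps.
have eps0 : 0 < eps by near: eps; exact: nbhs_right_gt.
have epsr2 : eps * (K + 1) <= r2.
  by rewrite -ler_pdivlMr //; near: eps; apply: nbhs_right_le; rewrite divr_gt0.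
apply/ereal_supP => _ [dB [ddelta [dx [hv hdB hdd hdx ->]]]].
rewrite lee_fin ler_pdivrMr ?mulr_gt0 //.
(* Since $\|\Delta x\| \le r < \|x\|$, the degenerate choice $\Delta x = -x$ is excluded. *)
have v0 : x + dx != 0.
  apply/eqP => /eqP; rewrite addr_eq0 => /eqP xdx; move: rx.
  by rewrite xdx vnorm2N ltNge hdx.
have e1 : delta + ddelta - delta = ddelta by rewrite addrC addKr.
have bnd : normc (delta + ddelta - delta) <= r by rewrite e1.
have [hQH hK] := hr _ bnd.
have := eigenvalue_shift_le hdB hQH v0 (ltW eps0) hv; rewrite e1 => hle.
have ddr2 : normc (delta + ddelta - delta) <= r2.
  rewrite e1; apply: le_trans hle _; apply: le_trans epsr2.
  by rewrite ler_pM2l.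
apply: le_trans hle _.
have -> : (K / normc delta + e) * (eps * normc delta) = eps * (K + e * normc delta).
  by field; rewrite gt_eqF.
by rewrite ler_pM2l // ltW // hr2.
Unshelve. all: by end_near. Qed.

(** Choose a unit-ball vector $u$ with $s(\delta)\|H(\delta)u\|$ close to $K$, and write $H(\delta)u
    = ax$. By continuity the eigenvalue can be moved to $l = \delta + \epsilon T$ with $T$ close to
    $K$; the eigenvector $a^{-1}H(l)u$ then tends to $x$, so that $\Delta x$ stays in the ball of
    radius $r$. *)
Lemma cond_quotients_ge r e : 0 < r ->
  (forall l, normc (l - delta) <= r -> mxeval d B l *m H l = (l - delta)%:M) ->
  0 < e -> \forall eps \near (0 : R)^'+,
    ((K / normc delta - e)%:E <= ereal_sup (cond_quotients d B delta x r eps))%E.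
Proof.
move=> r0 hr e0.
(* The intended value of $|\Delta\delta|/\epsilon$: strictly below $K$, by at most $e|\delta|$. The
   alternative [K / 2] keeps it positive. *)
pose T := Num.max (K - e * normc delta) (K / 2).
have T0 : 0 < T by rewrite lt_max divr_gt0 ?orbT.
have TK : T < K.
  by rewrite gt_max ltrBlDr ltrDl mulr_gt0 //= ltr_pdivrMr // ltr_pMr // ltr1n.
have : T / wsum delta < specnorm (H delta) by rewrite ltr_pdivrMr // mulrC.
move=> /specnorm_adherent[u u1]; rewrite ltr_pdivrMr // mulrC => hu.
have [a ha] := Hrange u.
have a0 : a != 0.
  apply: contraTneq hu => a0.
  by rewrite ha a0 scale0r vnorm20 mulr0 -leNgt ltW.
have na0 : 0 < normc a by rewrite normc_gt0.
have h1 : \forall l \near cnbhs delta, T < wsum l * vnorm2 (H l *m u).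
  by apply: (cvgr_gt _ _ _ hu); apply: cvgM; [exact: cvg_wsum|exact: mcont_vnorm2].
have h2 : \forall l \near cnbhs delta, vnorm2 (H l *m u - H delta *m u) < normc a * r.
  by apply: (cvgr_lt _ (mcont_vnorm2B u Hcont)); rewrite mulr_gt0.
have [r3 r30 hr3] := near_cnbhs (filterI h1 h2).
near=> eps.
have eps0 : 0 < eps by near: eps; exact: nbhs_right_gt.
have epsr3 : eps * T <= r3.
  by rewrite -ler_pdivlMr //; near: eps; apply: nbhs_right_le; rewrite divr_gt0.
have epsr : eps * T <= r.
  by rewrite -ler_pdivlMr //; near: eps; apply: nbhs_right_le; rewrite divr_gt0.
pose l := delta + (eps * T)%:C.
have hl : normc (l - delta) = eps * T.
  by rewrite /l addrC addKr normc_real ger0_norm // ltW // mulr_gt0.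
have [hT hdist] : T < wsum l * vnorm2 (H l *m u) /\
    vnorm2 (H l *m u - H delta *m u) < normc a * r by apply: hr3; rewrite hl.
have sl0 : 0 < wsum l.
  rewrite lt_neqAle wsum_ge0 andbT eq_sym; apply: contraTneq hT => ->.
  by rewrite mul0r -leNgt ltW.
have w0 : H l *m u != 0.
  by apply: contraTneq hT => ->; rewrite vnorm20 mulr0 -leNgt ltW.
have hQ : mxeval d B l *m H l = (l - delta)%:M by apply: hr; rewrite hl.
have [|dB hdB hdBw] := eigenvalue_shift_attained (eps := eps) hQ u1 w0 sl0.
  by rewrite hl; apply: ler_wpM2l; exact: ltW.
apply: le_ereal_sup_tmp; exists (T / normc delta)%:E; last first.
  rewrite lee_fin ler_pdivlMr // mulrBl mulfVK ?gt_eqF //.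
  by rewrite le_max lexx.
exists dB, (eps * T)%:C, (a^-1 *: (H l *m u) - x); split => //.
- by rewrite -/l [x + _]addrC subrK -scalemxAr hdBw scaler0.
- by rewrite normc_real ger0_norm // ltW // mulr_gt0.
- have -> : a^-1 *: (H l *m u) - x = a^-1 *: (H l *m u - H delta *m u).
    by rewrite scalerBr ha scalerA mulVf // scale1r.
  by rewrite vnorm2Z Normc.normcV mulrC ler_pdivrMr // mulrC ltW.
- rewrite normc_real ger0_norm; last by rewrite ltW // mulr_gt0.
  by congr EFin; field; rewrite !gt_eqF.
Unshelve. all: by end_near. Qed.

(** For every sufficiently small $r$ the inner limit already equals $K/|\delta|$, so the outer limit
    is that of an eventually constant function. *)
Lemma cond_number_resolvent : cond_number d B delta x = (K / normc delta)%:E.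
Proof.
have hK : \forall l \near cnbhs delta, wsum l * specnorm (H l) < K + 1.
  by apply: (cvgr_lt _ cvgK); rewrite ltrDl.
have [r1 r10 hr1] := near_cnbhs (filterI QH hK).
apply: lim_near_cst; first exact: ereal_hausdorff.
near=> r.
have r0 : 0 < r by near: r; exact: nbhs_right_gt.
have rr1 : r <= r1 by near: r; exact: nbhs_right_le.
have rx : r < vnorm2 x by near: r; apply: nbhs_right_lt; rewrite vnorm2_gt0.
apply: cvg_lim; first exact: ereal_hausdorff.
apply: cvg_ereal_close => e e0.
near=> eps; apply/andP; split; near: eps.
  by apply: cond_quotients_ge => // l hl; have [] := hr1 l (le_trans hl rr1).
apply: cond_quotients_le => // l hl.
by have [? /ltW ?] := hr1 l (le_trans hl rr1).
Unshelve. all: by end_near. Qed.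

End ConditionNumber.

(** * Resolvent at a simple eigenvalue *)

Section AdjugateKernel.
Variable F : fieldType.

(** Replace row $i$ of $N$ by the unit row $e_j^T$. The determinant becomes the cofactor, which is
    nonzero, and the new matrix still annihilates $v$. *)
Lemma ker_coord_eq0 m (N : 'M[F]_m) (i j : 'I_m) (v : 'cV[F]_m) :
  cofactor N i j != 0 -> N *m v = 0 -> v j 0 = 0 -> v = 0.
Proof.
move=> cof Nv vj.
pose N' := \matrix_(a, b) (if a == i then (b == j)%:R else N a b).
have dN' : \det N' = cofactor N i j.
  rewrite (expand_det_row _ i) (bigD1 j) //= mxE !eqxx mul1r big1 => [|b /negPf bj]; last first.
    by rewrite mxE eqxx bj mul0r.
  rewrite addr0 /cofactor; congr (_ * \det _).
  by apply/matrixP => a b; rewrite !mxE eq_sym (negPf (neq_lift _ _)).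
have uN' : N' \in unitmx by rewrite unitmxE dN' unitfE.
have N'v : N' *m v = 0.
  apply/matrixP => a b; rewrite ord1 !mxE.
  have [->|ai] := eqVneq a i.
    rewrite (bigD1 j) //= mxE !eqxx mul1r vj add0r big1 // => c /negPf cj.
    by rewrite mxE eqxx cj mul0r.
  under eq_bigr do rewrite mxE (negPf ai).
  by move/matrixP: Nv => /(_ a 0); rewrite !mxE.
by rewrite -(mulKmx uN' v) N'v mulmx0.
Qed.

(** Some cofactor is nonzero, so a kernel vector is determined by a single coordinate $j$; subtract
    the multiple of $x$ with the same coordinate. *)
Lemma ker_adj_line m (N : 'M[F]_m) (x v : 'cV[F]_m) :
  \adj N != 0 -> x != 0 -> N *m x = 0 -> N *m v = 0 -> exists a, v = a *: x.
Proof.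
move=> adjN x0 Nx Nv.
have [[j i] /= cof] : exists p : 'I_m * 'I_m, cofactor N p.2 p.1 != 0.
  apply/existsP; apply: contraNT adjN => /existsPn h; apply/eqP/matrixP => j i.
  by have := h (j, i); rewrite negbK !mxE => /eqP.
have xj : x j 0 != 0 by apply: contra_neq x0; exact: ker_coord_eq0 cof Nx.
exists (v j 0 / x j 0); apply/eqP; rewrite -subr_eq0; apply/eqP.
apply: (ker_coord_eq0 cof); first by rewrite mulmxBr -scalemxAr Nx Nv scaler0 subrr.
by rewrite !mxE divfK // subrr.
Qed.

End AdjugateKernel.

Section SimpleEigenvalue.
Variables (R : realType) (m d : nat) (B : nat -> 'M[R[i]]_m).
Implicit Types (l delta : R[i]).

Let PX : 'M[{poly R[i]}]_m := \sum_(i < d.+1) 'X^i *: map_mx polyC (B i).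

Let evalPX l : map_mx (horner_eval l) PX = mxeval d B l.
Proof.
rewrite /PX /mxeval raddf_sum /=; apply: eq_bigr => i _.
apply/matrixP => a b.
by rewrite !mxE /horner_eval hornerM hornerXn hornerC.
Qed.

(** The relation $H(\delta)Q(\delta) = 0$ serves the explicit form of the resolvent of the pencil at
    $\delta$; the other properties feed the formula for the condition number. *)
Definition resolvent_spec delta (x : 'cV[R[i]]_m) (H : R[i] -> 'M[R[i]]_m) :=
  [/\ mcont H delta,
      \forall l \near cnbhs delta, mxeval d B l *m H l = (l - delta)%:M,
      forall u : 'cV_m, exists a, H delta *m u = a *: x,
      H delta *m mxeval d B delta = 0 & H delta != 0].

(** Simplicity means $\det P = (\lambda-\delta)g$ with $g(\delta) \ne 0$. This makes
    $\operatorname{adj}P/g$ continuous at $\delta$, and it keeps the adjugate nonzero there, whence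
    a one-dimensional kernel. *)
Lemma simple_eigenvalue_resolvent delta (x : 'cV[R[i]]_m) :
  regular_mxpoly d B -> simple_eigenvalue d B delta ->
  right_eigenvector d B delta x ->
  (forall v : 'cV_m, mxeval d B delta *m v = 0 -> exists a, v = a *: x) /\
  exists H, resolvent_spec delta x H.
Proof.
rewrite /regular_mxpoly /simple_eigenvalue /mxpoly_det -/PX => reg simp [x0 Px].
have /dvdpP[g dg] : 'X - delta%:P %| \det PX.
  by rewrite -[X in X %| _]expr1 -mup_geq // simp.
have gd : g.[delta] != 0.
  have : ~~ (('X - delta%:P) ^+ 2 %| \det PX) by rewrite -mup_ltn // simp.
  apply: contraNneq => /eqP gd.
  by rewrite dg exprS expr1 dvdp_mul // dvdp_XsubCl.
(* If the adjugate vanished at $\delta$, it would be $(\lambda-\delta)G$ for a polynomial matrix $G$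
   with $GP = gI$; applied to $x$ at $\delta$, this gives $g(\delta)x = 0$. *)
have adj0 : map_mx (horner_eval delta) (\adj PX) != 0.
  apply: contraNneq x0 => adj0.
  pose G := \matrix_(i, j) (\adj PX i j %/ ('X - delta%:P)).
  have adjG : \adj PX = ('X - delta%:P) *: G.
    apply/matrixP => i j; rewrite [RHS]mxE [G i j]mxE mulrC divpK //.
    rewrite dvdp_XsubCl; apply/rootP.
    by move/matrixP: adj0 => /(_ i j); rewrite mxE [RHS]mxE.
  have GP : G *m PX = g%:M.
    have h : ('X - delta%:P) *: (G *m PX) = ('X - delta%:P) *: g%:M.
      by rewrite scalemxAl -adjG mul_adj_mx dg scale_scalar_mx mulrC.
    apply/matrixP => i j; move/matrixP: h => /(_ i j); rewrite mxE [RHS]mxE.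
    by move/mulfI; apply; rewrite polyXsubC_eq0.
  have : map_mx (horner_eval delta) (G *m PX) *m x = g.[delta] *: x.
    by rewrite GP map_scalar_mx mul_scalar_mx.
  rewrite map_mxM evalPX -mulmxA Px mulmx0 => /esym/eqP.
  by rewrite scaler_eq0 (negPf gd).
have adjE l : map_mx (horner_eval l) (\adj PX) = \adj (mxeval d B l).
  by rewrite map_mx_adj evalPX.
have detE l : \det (mxeval d B l) = g.[l] * (l - delta).
  rewrite -evalPX det_map_mx dg /= /horner_eval.
  by rewrite hornerM hornerXsubC.
have ker v : mxeval d B delta *m v = 0 -> exists a, v = a *: x.
  by apply: ker_adj_line => //; rewrite -adjE.
split => //.
exists (fun l => (g.[l])^-1 *: map_mx (horner_eval l) (\adj PX)); split.
- by apply: mcontZ; [apply: ccontV => //; exact: ccont_horner|exact: mcont_horner].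
- near=> l; have gl : g.[l] != 0.
    by near: l; exact: ccont_near_neq0 (ccont_horner g delta) gd.
  by rewrite -scalemxAr adjE mul_mx_adj detE scale_scalar_mx mulKf.
- move=> u; apply: ker.
  rewrite adjE -scalemxAl -scalemxAr mulmxA mul_mx_adj detE subrr mulr0.
  by rewrite mul_scalar_mx scale0r scaler0.
- by rewrite adjE -scalemxAl mul_adj_mx detE subrr mulr0 raddf0 scaler0.
- by rewrite scaler_eq0 invr_eq0 (negPf gd).
Unshelve. all: by end_near. Qed.

End SimpleEigenvalue.

(** * Block matrices *)

Section BlockMatrices.
Variables (R : realType) (k n : nat).
Implicit Types (F G : 'I_k -> 'I_k -> 'M[R[i]]_n) (v : 'I_k -> 'cV[R[i]]_n).

Definition bmx F : 'M[R[i]]_(\sum_(i < k) n) := \mxblock_(i < k, j < k) F i j.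
Definition bcol v : 'cV[R[i]]_(\sum_(i < k) n) := \mxcol_(i < k) v i.

Lemma bcolP (u : 'cV[R[i]]_(\sum_(i < k) n)) : exists v, u = bcol v.
Proof. by exists (fun i => submxcol u i); rewrite /bcol submxcolK. Qed.

Lemma bcol_inj v v' : bcol v = bcol v' -> v =1 v'.
Proof. by move=> /eq_mxcolP. Qed.

Lemma eq_bcol v v' : v =1 v' -> bcol v = bcol v'.
Proof. by move=> h; apply: eq_mxcol. Qed.

Lemma eq_bmx F G : F =2 G -> bmx F = bmx G.
Proof. by move=> h; apply: eq_mxblock. Qed.

Lemma mul_bmx_bcol F v : bmx F *m bcol v = bcol (fun i => \sum_j F i j *m v j).
Proof. exact: mul_mxblock_mxrow. Qed.

Lemma mul_bmx F G : bmx F *m bmx G = bmx (fun i l => \sum_j F i j *m G j l).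
Proof. exact: mul_mxblock. Qed.

Lemma scale_bmx (a : R[i]) F : a *: bmx F = bmx (fun i j => a *: F i j).
Proof. by apply/matrixP => i j; rewrite !mxE. Qed.

Lemma scale_bcol (a : R[i]) v : a *: bcol v = bcol (fun i => a *: v i).
Proof. by apply/matrixP => i j; rewrite !mxE. Qed.

Lemma bcol0 : bcol (fun=> 0) = 0.
Proof. by apply/matrixP => i j; rewrite !mxE. Qed.

Lemma vnorm2_bcol v : vnorm2 (bcol v) ^+ 2 = \sum_i vnorm2 (v i) ^+ 2.
Proof.
rewrite vnorm2_sqr; under [RHS]eq_bigr do rewrite vnorm2_sqr.
rewrite sig_big_dep /= (reindex _ tagnat.sig_bij_on) /=.
by apply: eq_bigr => l _; rewrite !mxE.
Qed.

Lemma vnorm2_block_le v j : vnorm2 (v j) <= vnorm2 (bcol v).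
Proof.
rewrite -(@ler_pXn2r _ 2) // ?nnegrE ?vnorm2_ge0 //.
rewrite vnorm2_bcol (bigD1 j) //= lerDl sumr_ge0 // => i _.
exact: sqr_ge0.
Qed.

(** Cauchy-Schwarz bounds each block of the image by $b\sqrt{k}$ times the norm of the vector;
    stacking the $k$ blocks costs another $\sqrt{k}$. *)
Lemma specnorm_bmx_le F (b : R) : 0 <= b ->
  (forall i j, specnorm (F i j) <= b) -> specnorm (bmx F) <= k%:R * b.
Proof.
move=> b0 hF; apply: specnorm_le => [|u]; first by rewrite mulr_ge0 ?ler0n.
have [w ->] := bcolP u.
rewrite -(@ler_pXn2r _ 2) // ?nnegrE ?mulr_ge0 ?ler0n ?vnorm2_ge0 //.
rewrite mul_bmx_bcol vnorm2_bcol exprMn vnorm2_bcol.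
have s0 : 0 <= \sum_j vnorm2 (w j) ^+ 2 by apply: sumr_ge0 => i _; exact: sqr_ge0.
have h1 : \sum_j vnorm2 (w j) <= Num.sqrt k%:R * Num.sqrt (\sum_j vnorm2 (w j) ^+ 2).
  have := @CauchySchwarz_sum R 'I_k (fun=> 1) (fun j => vnorm2 (w j)).
  rewrite (eq_bigr (fun j => vnorm2 (w j))); last by move=> j _; rewrite mul1r.
  congr (_ <= Num.sqrt _ * _).
  by under eq_bigr do rewrite expr1n; rewrite sumr_const card_ord.
have h2 i : vnorm2 (\sum_j F i j *m w j) ^+ 2
    <= b ^+ 2 * (k%:R * \sum_j vnorm2 (w j) ^+ 2).
  rewrite -[X in b ^+ 2 * X](@sqr_sqrtr _); last by rewrite mulr_ge0 ?ler0n.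
  rewrite sqrtrM ?ler0n // -exprMn ler_pXn2r // ?nnegrE ?mulr_ge0 ?sqrtr_ge0 ?vnorm2_ge0 //.
  apply: le_trans (ler_wpM2l b0 h1).
  apply: le_trans (ler_vnorm2_sum _ _ _) _; rewrite mulr_sumr.
  apply: ler_sum => j _; apply: le_trans (vnorm2_mul _ _) _.
  by apply: ler_wpM2r => //; exact: vnorm2_ge0.
apply: le_trans (ler_sum _ (fun i _ => h2 i)) _.
rewrite sumr_const card_ord -mulr_natl le_eqVlt; apply/orP; left; apply/eqP; ring.
Qed.

(** Test on vectors supported in block $j$ and keep only block $i$ of the image. *)
Lemma specnorm_block_le F i j : specnorm (F i j) <= specnorm (bmx F).
Proof.
apply: specnorm_le => [|w]; first exact: specnorm_ge0.
pose u := bcol (fun l => if l == j then w else 0).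
have nu : vnorm2 u = vnorm2 w.
  apply: (@pexpIrn _ 2); rewrite ?nnegrE ?vnorm2_ge0 // vnorm2_bcol (bigD1 j) //= eqxx.
  by rewrite big1 ?addr0 // => l /negPf ->; rewrite vnorm20 expr0n.
rewrite -nu; apply: le_trans (vnorm2_mul _ _).
rewrite mul_bmx_bcol; apply: le_trans (vnorm2_block_le _ i).
rewrite (bigD1 j) //= eqxx big1 ?addr0 // => l /negPf ->.
by rewrite mulmx0.
Qed.

Lemma vnorm2_bcol_scale (c : 'I_k -> R[i]) (w : 'cV[R[i]]_n) :
  vnorm2 (bcol (fun i => c i *: w)) = Num.sqrt (\sum_i normc (c i) ^+ 2) * vnorm2 w.
Proof.
have s0 : 0 <= \sum_i normc (c i) ^+ 2 by apply: sumr_ge0 => i _; exact: sqr_ge0.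
apply: (@pexpIrn _ 2); rewrite ?nnegrE ?mulr_ge0 ?sqrtr_ge0 ?vnorm2_ge0 //.
rewrite vnorm2_bcol exprMn sqr_sqrtr // mulr_suml.
by apply: eq_bigr => i _; rewrite vnorm2Z exprMn.
Qed.

Lemma vnorm2_lincomb_le (c : 'I_k -> R[i]) v :
  vnorm2 (\sum_j c j *: v j)
    <= Num.sqrt (\sum_i normc (c i) ^+ 2) * vnorm2 (bcol v).
Proof.
apply: le_trans (ler_vnorm2_sum _ _ _) _.
under eq_bigr do rewrite vnorm2Z.
apply: le_trans (CauchySchwarz_sum _ _) _.
by rewrite -vnorm2_bcol sqrtr_sqr ger0_norm // vnorm2_ge0.
Qed.

Lemma mul_outer_bcol (c : 'I_k -> R[i]) (H : 'M[R[i]]_n) v :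
  bmx (fun i j => (c i * c j) *: H) *m bcol v
    = bcol (fun i => c i *: (H *m \sum_j c j *: v j)).
Proof.
rewrite mul_bmx_bcol; apply: eq_bcol => i.
rewrite mulmx_sumr scaler_sumr; apply: eq_bigr => j _.
by rewrite -scalemxAl -scalemxAr scalerA.
Qed.

(** The matrix is $(c \otimes I)H(c^T \otimes I)$, which gives the upper bound. The vectors $\bar c
    \otimes w$ show that it is sharp, because $c^T \bar c = \|c\|^2$. *)
Lemma specnorm_outer_bmx (c : 'I_k -> R[i]) (H : 'M[R[i]]_n) :
  specnorm (bmx (fun i j => (c i * c j) *: H))
    = (\sum_i normc (c i) ^+ 2) * specnorm H.
Proof.
set S := \sum_i normc (c i) ^+ 2.
have S0 : 0 <= S by apply: sumr_ge0 => i _; exact: sqr_ge0.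
apply/eqP; rewrite eq_le; apply/andP; split.
  apply: specnorm_le => [|u]; first by rewrite mulr_ge0 ?specnorm_ge0.
  have [v ->] := bcolP u.
  rewrite mul_outer_bcol vnorm2_bcol_scale -/S.
  rewrite -{2}(sqr_sqrtr S0) expr2 -!mulrA ler_wpM2l ?sqrtr_ge0 //.
  apply: le_trans (vnorm2_mul _ _) _.
  rewrite mulrCA; apply: ler_wpM2l; first exact: specnorm_ge0.
  exact: vnorm2_lincomb_le.
have [->|Sn0] := eqVneq S 0; first by rewrite mul0r specnorm_ge0.
have Sp : 0 < S by rewrite lt_neqAle eq_sym Sn0.
rewrite mulrC -ler_pdivlMr //; apply: specnorm_le => [|w].
  by rewrite divr_ge0 ?specnorm_ge0.
have := vnorm2_mul (bmx (fun i j => (c i * c j) *: H)) (bcol (fun j => (c j)^* *: w)).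
rewrite mul_outer_bcol vnorm2_bcol_scale -/S.
have -> : \sum_j c j *: ((c j)^* *: w) = S%:C *: w.
  rewrite /S rmorph_sum scaler_suml; apply: eq_bigr => j _.
  by rewrite scalerA mul_conjc.
rewrite -scalemxAr vnorm2Z normc_real ger0_norm // (vnorm2_bcol_scale (fun j => (c j)^*)).
under [X in Num.sqrt X * vnorm2 w]eq_bigr do rewrite normc_conj.
rewrite -/S mulrCA [X in _ <= X]mulrCA.
rewrite [X in X <= _]mulrCA ler_pM2l ?sqrtr_gt0 // => h.
by rewrite -mulrA [S^-1 * _]mulrC mulrA ler_pdivlMr // mulrC.
Qed.

End BlockMatrices.

(** * Continuity of determinants, inverses and block matrices *)

Section ContinuousInverse.
Variable R : realType.
Implicit Types d : R[i].

Lemma ccont_prod (I : Type) (r : seq I) (F : I -> R[i] -> R[i]) d :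
  (forall i, ccont (F i) d) -> ccont (fun l => \prod_(i <- r) F i l) d.
Proof.
move=> h; elim: r => [|j r IH].
  have -> : (fun l => \prod_(i <- [::]) F i l) = (fun=> 1).
    by apply/funext => l; rewrite big_nil.
  exact: ccont_cst.
have -> : (fun l => \prod_(i <- j :: r) F i l)
  = (fun l => F j l * \prod_(i <- r) F i l).
  by apply/funext => l; rewrite big_cons.
exact: ccontM.
Qed.

Lemma ccont_det m (M : R[i] -> 'M[R[i]]_m) d :
  mcont M d -> ccont (fun l => \det (M l)) d.
Proof.
move=> cM; apply: ccont_sum => s _; apply: ccontM; first exact: ccont_cst.
by apply: ccont_prod => i; exact: cM.
Qed.

Lemma mcont_invmx m (M : R[i] -> 'M[R[i]]_m) d :
  (forall l, M l \in unitmx) -> mcont M d -> mcont (fun l => invmx (M l)) d.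
Proof.
move=> uM cM.
have -> : (fun l => invmx (M l)) = (fun l => (\det (M l))^-1 *: \adj (M l)).
  by apply/funext => l; rewrite /invmx uM.
apply: mcontZ; first by apply: ccontV; [exact: ccont_det|rewrite -unitfE -unitmxE uM].
move=> i j.
have -> : (fun l => \adj (M l) i j)
  = (fun l => (-1) ^+ (j + i) * \det (row' j (col' i (M l)))).
  by apply/funext => l; rewrite mxE.
apply: ccontM; first exact: ccont_cst.
apply: ccont_det => a b.
have -> : (fun l => row' j (col' i (M l)) a b) = (fun l => M l (lift j a) (lift i b)).
  by apply/funext => l; rewrite !mxE.
exact: cM.
Qed.

Lemma mcont_bmx k n (F : R[i] -> 'I_k -> 'I_k -> 'M[R[i]]_n) d :
  (forall i j, mcont (fun l => F l i j) d) ->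
  mcont (fun l => bmx (F l)) d.
Proof.
move=> cF a b.
have -> : (fun l => bmx (F l) a b)
  = (fun l => F l (tagnat.sig1 a) (tagnat.sig1 b) (tagnat.sig2 a) (tagnat.sig2 b)).
  by apply/funext => l; rewrite mxE.
exact: cF.
Qed.

Lemma unitmx_ker0 m (M : 'M[R[i]]_m) :
  (forall v : 'cV_m, M *m v = 0 -> v = 0) -> M \in unitmx.
Proof.
move=> h; rewrite -unitmx_tr unitmxE unitfE; apply/det0P => -[v v0 vM].
have /h vT : M *m v^T = 0 by rewrite -[LHS]trmxK trmx_mul trmxK vM trmx0.
by move: v0; rewrite -[v]trmxK vT trmx0 eqxx.
Qed.

End ContinuousInverse.

(** * Resolvent of a pencil satisfying an ansatz identity *)

Section AnsatzPencil.
Variables (R : realType) (n K : nat) (tau : 'I_K.+1).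
Variables (P : R[i] -> 'M[R[i]]_n) (D : R[i] -> 'I_K.+1 -> 'I_K.+1 -> 'M[R[i]]_n).
Implicit Types (l delta : R[i]) (v : 'I_K.+1 -> 'cV[R[i]]_n).

(** With $\Lambda = (l^K, \ldots, l, 1)^T$, this and the next hypothesis say $D(l)(\Lambda \otimes
    I) = e_\tau \otimes P(l)$ and $(\Lambda^T \otimes I)D(l) = e_\tau^T \otimes P(l)$. Block indices
    run from 0 to $K = k-1$, so [tau] is $t-1$. *)
Hypothesis ansatz_r : forall l i,
  \sum_(j < K.+1) l ^+ (K - j) *: D l i j = if i == tau then P l else 0.
Hypothesis ansatz_l : forall l j,
  \sum_(i < K.+1) l ^+ (K - i) *: D l i j = if j == tau then P l else 0.
(** $D(l)$ without its last block column and its block row [tau] is injective. For $D_1$ and $D_k$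
    this is what the nonsingularity of $A_0$ or $A_k$ provides. *)
Hypothesis trunc_inj : forall l v, v ord_max = 0 ->
  (forall i, i != tau -> \sum_j D l i j *m v j = 0) -> forall j, v j = 0.

Let W l (i j : 'I_K.+1) : 'M[R[i]]_n :=
  if j == ord_max then (if i == tau then 1%:M else 0) else D l i j.

(** Subtracting $\Lambda \otimes v_K$ from $v$ clears the last block and, by the ansatz identity,
    changes the image in block row [tau] only; injectivity of the truncated matrix makes the
    difference zero. *)
Lemma ansatz_kernel l v : bmx (D l) *m bcol v = 0 ->
  (forall j, v j = l ^+ (K - j) *: v ord_max) /\ P l *m v ord_max = 0.
Proof.
rewrite mul_bmx_bcol -(bcol0 _ K.+1 n) => /bcol_inj hv.
pose w j := v j - l ^+ (K - j) *: v ord_max.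
have hw i : \sum_j D l i j *m w j = if i == tau then - (P l *m v ord_max) else 0.
  under eq_bigr do rewrite mulmxBr.
  rewrite sumrB hv sub0r.
  under eq_bigr do rewrite -scalemxAr scalemxAl.
  by rewrite -mulmx_suml ansatz_r; case: eqP => // _; rewrite mul0mx oppr0.
have w0 : forall j, w j = 0.
  apply: (@trunc_inj l w); first by rewrite /w subnn expr0 scale1r subrr.
  by move=> i /negPf it; rewrite hw it.
split=> [j|]; first by apply/eqP; rewrite -subr_eq0 -/(w j) w0.
have := hw tau; rewrite eqxx big1 => [/eqP|j _]; last by rewrite w0 mulmx0.
by rewrite eq_sym oppr_eq0 => /eqP.
Qed.

(** The last block column of [W] is zero outside row [tau], so a kernel vector has all blocks but
    the last equal to zero by [trunc_inj]; row [tau] then annihilates the last one. *)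
Let W_unit l : bmx (W l) \in unitmx.
Proof.
apply: unitmx_ker0 => u; have [v ->] := bcolP u.
rewrite mul_bmx_bcol -(bcol0 _ K.+1 n) => /bcol_inj hv.
pose w j := if j == ord_max then 0 else v j.
have hw i : \sum_j W l i j *m v j = \sum_j D l i j *m w j
    + (if i == tau then v ord_max else 0).
  rewrite (bigD1 ord_max) //= [in RHS](bigD1 ord_max) //= /W /w !eqxx mulmx0 add0r addrC.
  congr (_ + _); first by apply: eq_bigr => j /negPf ->.
  by case: eqP; rewrite ?mul1mx ?mul0mx.
have w0 : forall j, w j = 0.
  apply: (@trunc_inj l w); first by rewrite /w eqxx.
  by move=> i /negPf it; have := hw i; rewrite hv it addr0.
have vmax : v ord_max = 0.
  have := hw tau; rewrite hv eqxx big1 ?add0r // => j _.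
  by rewrite w0 mulmx0.
apply: eq_bcol => j; have := w0 j; rewrite /w; case: eqP => // -> _; exact: vmax.
Qed.

Variables (delta : R[i]) (HP : R[i] -> 'M[R[i]]_n).
Hypotheses (delta0 : delta != 0)
  (Dcont : forall i j, mcont (fun l => D l i j) delta) (HPcont : mcont HP delta)
  (PH : \forall l \near cnbhs delta, P l *m HP l = (l - delta)%:M)
  (HP0 : HP delta *m P delta = 0).

Let Z l (i j : 'I_K.+1) : 'M[R[i]]_n :=
  if j == ord_max then l ^+ (K - i) *: HP l
  else if i == j then (l - delta)%:M else 0.

(* [Z] consists of the columns of [(l - delta) D(l)^-1 W(l)]: the blocks of
   [D(l)^-1 W(l)] are those of the identity, except in the last block column,
   where the ansatz identity gives them explicitly. *)
Let DZ l : P l *m HP l = (l - delta)%:M -> bmx (D l) *m bmx (Z l) = (l - delta) *: bmx (W l).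
Proof.
move=> hP; rewrite mul_bmx scale_bmx; apply: eq_bmx => i b; rewrite /Z /W.
have [bm|bm] := eqVneq b ord_max.
  under eq_bigr do rewrite -scalemxAr scalemxAl.
  rewrite -mulmx_suml ansatz_r; case: eqP => _; first by rewrite hP scalemx1.
  by rewrite mul0mx scaler0.
rewrite (bigD1 b) //= eqxx big1 ?addr0 ?mul_mx_scalar // => j /negPf ->.
by rewrite mulmx0.
Qed.

Definition ansatz_resolvent l := bmx (Z l) *m invmx (bmx (W l)).

Lemma ansatz_resolvent_cont : mcont ansatz_resolvent delta.
Proof.
apply: mcontM; last first.
  apply: mcont_invmx => //; apply: mcont_bmx => i j; rewrite /W.
  by case: eqP => // _; case: eqP => _; exact: mcont_cst.
apply: mcont_bmx => i j; rewrite /Z; case: eqP => _.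
  apply: mcontZ => //.
  have -> : (fun l : R[i] => l ^+ (K - i)) = horner 'X^(K - i).
    by apply/funext => l; rewrite hornerXn.
  exact: ccont_horner.
case: eqP => _; last exact: mcont_cst.
move=> a b; have -> : (fun l => (l - delta)%:M a b) = (fun l : R[i] => (l - delta) * (a == b)%:R).
  by apply/funext => l; rewrite mxE mulr_natr.
apply: ccontM; last exact: ccont_cst.
by apply: ccontD; [exact: ccont_id|exact: ccont_cst].
Qed.

Lemma ansatz_resolventP :
  \forall l \near cnbhs delta, bmx (D l) *m ansatz_resolvent l = (l - delta)%:M.
Proof.
near=> l.
have hP : P l *m HP l = (l - delta)%:M by near: l.
by rewrite mulmxA DZ // -scalemxAl mulmxV // scalemx1.
Unshelve. all: by end_near. Qed.

(** It suffices to multiply the right-hand side by $W(\delta)$ and recover $Z(\delta)$. In the last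
    block column $e_\tau \otimes I$ produces the factor $\delta^{K-\tau}$, which cancels; the other
    columns vanish on both sides, by the left ansatz identity with $H_P(\delta)P(\delta) = 0$ and by
    $l - \delta = 0$. *)
Lemma ansatz_resolventE : ansatz_resolvent delta =
  (delta ^+ (K - tau))^-1
    *: bmx (fun i j => (delta ^+ (K - i) * delta ^+ (K - j)) *: HP delta).
Proof.
have d0 : delta ^+ (K - tau) != 0 by rewrite expf_neq0.
suff h : bmx (Z delta) = ((delta ^+ (K - tau))^-1
    *: bmx (fun i j => (delta ^+ (K - i) * delta ^+ (K - j)) *: HP delta))
    *m bmx (W delta) by rewrite /ansatz_resolvent h mulmxK.
rewrite -scalemxAl mul_bmx scale_bmx; apply: eq_bmx => i b.
have -> : \sum_(j < K.+1) (delta ^+ (K - i) * delta ^+ (K - j)) *: HP delta *m W delta j b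
  = delta ^+ (K - i) *: (HP delta *m \sum_(j < K.+1) delta ^+ (K - j) *: W delta j b).
  rewrite mulmx_sumr scaler_sumr; apply: eq_bigr => j _.
  by rewrite -scalemxAl -scalemxAr scalerA.
rewrite /Z /W; have [bm|bm] := eqVneq b ord_max.
  rewrite (bigD1 tau) //= eqxx big1 => [|j /negPf ->]; last by rewrite scaler0.
  by rewrite addr0 -scalemxAr mulmx1 !scalerA mulrAC mulVf ?mul1r.
rewrite ansatz_l; have -> : HP delta *m (if b == tau then P delta else 0) = 0.
  by case: eqP => // _; rewrite mulmx0.
by rewrite !scaler0; case: eqP => // _; rewrite subrr raddf0.
Qed.

(** The eigenvector $z$ is a nonzero multiple of $\Lambda \otimes x$ by [ansatz_kernel], and the
    range of the resolvent at $\delta$ consists of multiples of $\Lambda \otimes x$ too. *)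
Lemma ansatz_resolvent_spec (x : 'cV[R[i]]_n) (z : 'cV[R[i]]_(\sum_(i < K.+1) n)) :
  (forall v : 'cV_n, P delta *m v = 0 -> exists a, v = a *: x) ->
  (forall u : 'cV_n, exists a, HP delta *m u = a *: x) ->
  z != 0 -> bmx (D delta) *m z = 0 ->
  forall u, exists a, ansatz_resolvent delta *m u = a *: z.
Proof.
move=> ker rg z0 Dz u; move: z0 Dz.
have [v ->] := bcolP z; have [w ->] := bcolP u => v0 /ansatz_kernel[vE Pv].
have [a va] := ker _ Pv.
have a0 : a != 0.
  apply: contraNneq v0 => a0; rewrite -(bcol0 _ K.+1 n); apply/eqP/eq_bcol => j.
  by rewrite vE va a0 scale0r scaler0.
have [b hb] := rg (\sum_(j < K.+1) delta ^+ (K - j) *: w j).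
exists ((delta ^+ (K - tau))^-1 * b / a).
rewrite ansatz_resolventE -scalemxAl mul_outer_bcol hb !scale_bcol.
apply: eq_bcol => j; rewrite vE va !scalerA; congr (_ *: _).
by field; rewrite a0 expf_neq0.
Qed.

Lemma specnorm_ansatz_resolvent :
  specnorm (ansatz_resolvent delta)
    = (normc delta ^+ (K - tau))^-1 * (\sum_(i < K.+1) normc delta ^+ (2 * i))
      * specnorm (HP delta).
Proof.
rewrite ansatz_resolventE specnormZ specnorm_outer_bmx Normc.normcV normcX mulrA.
congr (_ * _ * _); rewrite (reindex_inj rev_ord_inj) /=.
apply: eq_bigr => i _; rewrite normcX -exprM mulnC; congr (_ ^+ (2 * _)%N).
by rewrite subSS subKn // -ltnS.
Qed.

End AnsatzPencil.

(** * The pencils D_1 and D_k *)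

Section Pencils.
Variables (R : realType) (n K : nat) (A : nat -> 'M[R[i]]_n).
Implicit Types (l : R[i]).

(** Block indices start at 1 in the coefficients and at 0 here, hence the successors. *)
Definition pencil_block (F1 F0 : nat -> nat -> 'M[R[i]]_n) l (i j : 'I_K.+1) :=
  l *: F1 i.+1 j.+1 - F0 i.+1 j.+1.

Lemma mxeval_pencil F1 F0 l :
  mxeval 1 (pencil (block_matrix K.+1 F1) (block_matrix K.+1 F0)) l
    = bmx (pencil_block F1 F0 l).
Proof.
rewrite /mxeval [LHS]big_ord_recl [X in _ + X]big_ord1 /= /bump /= addn0.
rewrite expr0 scale1r expr1 /pencil /= addrC.
by apply/matrixP => a b; rewrite !mxE.
Qed.

Let D1F1 (i j : nat) := if (i == 1%N) && (j == 1%N) then A K.+1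
    else if (i == 1%N) || (j == 1%N) then 0
    else if (i + j <= K.+1 + 2)%N then - A (K.+1 + 2 - i - j)%N else 0.
Let D1F0 (i j : nat) := if (i + j <= K.+1 + 1)%N then - A (K.+1 + 1 - i - j)%N else 0.
Let DkF1 (i j : nat) :=
  if (K.+1 + 1 <= i + j)%N then A (2 * K.+1 + 1 - i - j)%N else 0.
Let DkF0 (i j : nat) := if (i == K.+1) && (j == K.+1) then - A 0%N
    else if (i == K.+1) || (j == K.+1) then 0
    else if (K.+1 <= i + j)%N then A (2 * K.+1 - i - j)%N else 0.

Definition D1_block := pencil_block D1F1 D1F0.
Definition Dk_block := pencil_block DkF1 DkF0.

Lemma mxeval_D1 l : mxeval 1 (D1 K.+1 A) l = bmx (D1_block l).
Proof. exact: mxeval_pencil. Qed.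

Lemma mxeval_Dk l : mxeval 1 (Dk K.+1 A) l = bmx (Dk_block l).
Proof. exact: mxeval_pencil. Qed.

Lemma D1_block_sym l i j : D1_block l i j = D1_block l j i.
Proof.
rewrite /D1_block /pencil_block /D1F1 /D1F0 (addnC i.+1) andbC orbC.
by rewrite [(_ - i.+1 - _)%N]subnAC [(K.+1 + 1 - i.+1 - _)%N]subnAC.
Qed.

Lemma Dk_block_sym l i j : Dk_block l i j = Dk_block l j i.
Proof.
rewrite /Dk_block /pencil_block /DkF1 /DkF0 (addnC i.+1) andbC orbC.
by rewrite [(_ - i.+1 - _)%N]subnAC [(2 * K.+1 - i.+1 - _)%N]subnAC.
Qed.

(** Below the first block row, block $b+1$ of $L_1$ equals block $b$ of $L_0$, so the row sees only
    the differences $y_b - l y_{b+1}$. These vanish on $\Lambda$, which gives the ansatz identity;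
    as unknowns they form a triangular system, which gives injectivity. *)
Lemma D1_row p l (a : 'I_K.+1) (y : nat -> 'M[R[i]]_(n, p)) : (0 < a)%N ->
  \sum_(b < K.+1) D1_block l a b *m y b
    = \sum_(b < K) if (a + b <= K)%N then A (K - a - b)%N *m (y b - l *: y b.+1) else 0.
Proof.
move=> a0; rewrite /D1_block /pencil_block.
under eq_bigr do rewrite mulmxBl.
rewrite sumrB big_ord_recl [X in _ - X]big_ord_recr /=.
have -> : D1F1 a.+1 1 = 0 by rewrite /D1F1 eqSS (gtn_eqF a0).
have -> : D1F0 a.+1 K.+1 = 0 by rewrite /D1F0 ifF //; apply/negbTE; lia.
rewrite scaler0 !mul0mx add0r addr0 -sumrB; apply: eq_bigr => b _ /=.
rewrite /bump /= add1n /D1F1 /D1F0 !eqSS (gtn_eqF a0) /=.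
have -> : (a.+1 + b.+2 <= K.+1 + 2)%N = (a + b <= K)%N by lia.
have -> : (a.+1 + b.+1 <= K.+1 + 1)%N = (a + b <= K)%N by lia.
case: leqP => ab; last by rewrite scaler0 !mul0mx subrr.
have -> : (K.+1 + 2 - a.+1 - b.+2 = K - a - b)%N by lia.
have -> : (K.+1 + 1 - a.+1 - b.+1 = K - a - b)%N by lia.
by rewrite mulmxBr scalerN !mulNmx opprK -scalemxAl -scalemxAr addrC.
Qed.

(** The same shift between $L_1$ and $L_0$, now in all block rows but the last. *)
Lemma Dk_row p l (a : 'I_K.+1) (y : nat -> 'M[R[i]]_(n, p)) : (a < K)%N ->
  \sum_(b < K.+1) Dk_block l a b *m y b
    = \sum_(b < K) if (K <= a + b.+1)%N then A (2 * K - a - b)%N *m (l *: y b.+1 - y b) else 0.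
Proof.
move=> aK; rewrite /Dk_block /pencil_block.
under eq_bigr do rewrite mulmxBl.
rewrite sumrB big_ord_recl [X in _ - X]big_ord_recr /=.
have -> : DkF1 a.+1 1 = 0 by rewrite /DkF1 ifF //; apply/negbTE; lia.
have -> : DkF0 a.+1 K.+1 = 0 by rewrite /DkF0 !eqSS (ltn_eqF aK) eqxx.
rewrite scaler0 !mul0mx add0r addr0 -sumrB; apply: eq_bigr => b _ /=.
rewrite /bump /= add1n /DkF1 /DkF0 !eqSS (ltn_eqF aK) (ltn_eqF (ltn_ord b)) /=.
have -> : (K.+1 + 1 <= a.+1 + b.+2)%N = (K <= a + b.+1)%N by lia.
have -> : (K < a.+1 + b.+1)%N = (K <= a + b.+1)%N by lia.
case: leqP => ab; last by rewrite scaler0 !mul0mx subrr.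
have -> : (2 * K.+1 + 1 - a.+1 - b.+2 = 2 * K - a - b)%N by lia.
have -> : (2 * K.+1 - a.+1 - b.+1 = 2 * K - a - b)%N by lia.
by rewrite mulmxBr -scalemxAl -scalemxAr.
Qed.

(** Block [b] of $\Lambda \otimes I$. *)
Let powers l (b : nat) : 'M[R[i]]_n := (l ^+ (K - b))%:M.

Let powersS l (b : 'I_K) : powers l b = l *: powers l b.+1.
Proof.
by rewrite /powers scale_scalar_mx; congr (_%:M); rewrite -exprS -subSn // subSS.
Qed.

Lemma D1_ansatz l (i : 'I_K.+1) :
  \sum_(j < K.+1) l ^+ (K - j) *: D1_block l i j
    = if i == ord0 then mxeval K.+1 A l else 0.
Proof.
case: eqP => [->|/eqP i0].
  rewrite /mxeval [RHS]big_ord_recr /= [in RHS](reindex_inj rev_ord_inj) /=.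
  rewrite /D1_block /pencil_block.
  under eq_bigr do rewrite scalerBr.
  rewrite sumrB big_ord_recl big1 => [|j _]; last first.
    by rewrite /D1F1 lift0 /= !scaler0.
  rewrite addr0 subn0 scalerA -exprSr addrC; congr (_ + _).
  rewrite -sumrN; apply: eq_bigr => j _; rewrite /D1F0.
  have jK := ltn_ord j.
  have -> : (1 + j.+1 <= K.+1 + 1)%N by lia.
  have -> : (K.+1 + 1 - 1 - j.+1 = K - j)%N by lia.
  by rewrite scalerN opprK subSS.
have {}i0 : (0 < i)%N by rewrite lt0n.
transitivity (\sum_(j < K.+1) D1_block l i j *m powers l j).
  by apply: eq_bigr => j _; rewrite /powers mul_mx_scalar.
rewrite D1_row // big1 // => b _; case: ifP => // _.
by rewrite powersS subrr mulmx0.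
Qed.

Lemma Dk_ansatz l (i : 'I_K.+1) :
  \sum_(j < K.+1) l ^+ (K - j) *: Dk_block l i j
    = if i == ord_max then mxeval K.+1 A l else 0.
Proof.
case: eqP => [->|/eqP iK].
  rewrite /mxeval [RHS]big_ord_recl /= expr0 scale1r [in RHS](reindex_inj rev_ord_inj) /=.
  rewrite /Dk_block /pencil_block.
  under eq_bigr do rewrite scalerBr.
  rewrite sumrB [X in _ - X]big_ord_recr [X in _ - (X + _)]big1 => [|j _]; last first.
    by rewrite /DkF0 /= eqxx !eqSS (ltn_eqF (ltn_ord j)) /= scaler0.
  rewrite add0r /DkF0 /= !eqxx /= subnn expr0 scale1r opprK addrC; congr (_ + _).
  apply: eq_bigr => j _; rewrite /DkF1 /bump /=.
  have jK := ltn_ord j.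
  have -> : (K.+1 + 1 <= K.+1 + j.+1)%N by lia.
  have -> : (2 * K.+1 + 1 - K.+1 - j.+1 = 1 + (K.+1 - j.+1))%N by lia.
  by rewrite scalerA -exprSr add1n subSS.
have {}iK : (i < K)%N by have := ltn_ord i; move: iK; rewrite -val_eqE /=; lia.
transitivity (\sum_(j < K.+1) Dk_block l i j *m powers l j).
  by apply: eq_bigr => j _; rewrite /powers mul_mx_scalar.
rewrite Dk_row // big1 // => b _; case: ifP => // _.
by rewrite powersS subrr mulmx0.
Qed.

(** Forward substitution in a block lower triangular Toeplitz system with invertible diagonal
    block. *)
Lemma toeplitz_inj (M : nat -> 'M[R[i]]_n) (s : nat -> 'cV[R[i]]_n) : M 0%N \in unitmx ->
  (forall c, (c < K)%N -> \sum_(b < K) (if (b <= c)%N then M (c - b)%N *m s b else 0) = 0) ->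
  forall c, (c < K)%N -> s c = 0.
Proof.
move=> uM h c; elim/ltn_ind: c => c IH cK.
have := h c cK; rewrite (bigD1 (Ordinal cK)) //= leqnn subnn big1 => [|b bc].
  by rewrite addr0 => e; rewrite -(mulKmx uM (s c)) e mulmx0.
case: leqP => // bc'; rewrite IH ?mulmx0 //.
by rewrite ltn_neqAle bc' andbT.
Qed.

Lemma geometric_zero l (y : nat -> 'cV[R[i]]_n) : y K = 0 ->
  (forall b, (b < K)%N -> y b = l *: y b.+1) -> forall b, (b <= K)%N -> y b = 0.
Proof.
move=> yK h b bK; rewrite -(subKn bK).
elim: (K - b)%N (leq_subr b K) => [|e IH] eK; first by rewrite subn0.
rewrite h; last by lia.
have -> : (K - e.+1).+1 = (K - e)%N by lia.
by rewrite IH ?scaler0 // ltnW.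
Qed.

(** Makes the blocks total in the index, as the row formulas expect; only the values for [b <= K]
    matter. *)
Let extend (v : 'I_K.+1 -> 'cV[R[i]]_n) (b : nat) := v (inord b).

Let extendE v (b : 'I_K.+1) : extend v b = v b.
Proof. by rewrite /extend inord_val. Qed.

(** Reading the block rows upwards, $a = K - c$, turns the Hankel system in the differences $v_b - l
    v_{b+1}$ into a lower triangular Toeplitz one with $A_0$ on the diagonal. The differences
    vanish, and so do all blocks, by downward recursion from the last. *)
Lemma D1_trunc_inj l (v : 'I_K.+1 -> 'cV[R[i]]_n) : A 0%N \in unitmx ->
  v ord_max = 0 -> (forall i, i != ord0 -> \sum_j D1_block l i j *m v j = 0) ->
  forall j, v j = 0.
Proof.
move=> uA vK hv.
have s0 b : (b < K)%N -> extend v b - l *: extend v b.+1 = 0.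
  apply: (@toeplitz_inj A (fun b => extend v b - l *: extend v b.+1)) => // c cK.
  have aK : (K - c < K.+1)%N by lia.
  have a0 : (0 < Ordinal aK)%N by rewrite /= subn_gt0.
  have := D1_row l (extend v) a0.
  have -> : \sum_(b0 < K.+1) D1_block l (Ordinal aK) b0 *m extend v b0 = 0.
    rewrite -[RHS](hv (Ordinal aK)); last by rewrite -val_eqE -lt0n.
    by apply: eq_bigr => j _; rewrite extendE.
  move=> e0; rewrite [RHS]e0; apply: eq_bigr => j _ /=.
  have -> : (K - c + j <= K)%N = (j <= c)%N by lia.
  by case: leqP => // jc; congr (A _ *m _); lia.
move=> j; rewrite -extendE; apply: (@geometric_zero l).
- by rewrite (extendE v ord_max).
- by move=> b /s0 /eqP; rewrite subr_eq0 => /eqP.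
- by rewrite -ltnS.
Qed.

(** As for $D_1$, but the order of the unknowns is reversed instead of that of the rows; the
    diagonal block is then $A_k$. *)
Lemma Dk_trunc_inj l (v : 'I_K.+1 -> 'cV[R[i]]_n) : A K.+1 \in unitmx ->
  v ord_max = 0 -> (forall i, i != ord_max -> \sum_j Dk_block l i j *m v j = 0) ->
  forall j, v j = 0.
Proof.
move=> uA vK hv.
pose s b := l *: extend v b.+1 - extend v b.
have s0 b : (b < K)%N -> s b = 0.
  move=> bK; have e : (K.-1 - (K.-1 - b) = b)%N by lia.
  rewrite -e.
  apply: (@toeplitz_inj (fun i => A (K.+1 - i)%N) (fun e => s (K.-1 - e)%N)) => //
    [c cK|]; last by lia.
  have aK : (c < K.+1)%N by lia.
  have := @Dk_row _ l (Ordinal aK) (extend v) cK.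
  have -> : \sum_(b0 < K.+1) Dk_block l (Ordinal aK) b0 *m extend v b0 = 0.
    rewrite -[RHS](hv (Ordinal aK)); last by rewrite -val_eqE /= ltn_eqF.
    by apply: eq_bigr => j _; rewrite extendE.
  move=> e0; rewrite [RHS]e0 [RHS](reindex_inj rev_ord_inj); apply: eq_bigr => j _ /=.
  have jK := ltn_ord j.
  have -> : (K <= c + (K - j.+1).+1)%N = (j <= c)%N by lia.
  case: leqP => // jc; rewrite -/(s _); congr (A _ *m s _); lia.
move=> j; rewrite -extendE; apply: (@geometric_zero l).
- by rewrite (extendE v ord_max).
- by move=> b /s0 /eqP; rewrite subr_eq0 => /eqP.
- by rewrite -ltnS.
Qed.

End Pencils.

(** * Comparison of the condition numbers *)

Section GeometricSums.
Variable R : realFieldType.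
Implicit Types r : R.

Lemma geometric_split r k :
  (1 + r) * \sum_(i < k) r ^+ (2 * i) = \sum_(j < k + k) r ^+ j.
Proof.
elim: k => [|k IH]; first by rewrite !big_ord0 mulr0.
rewrite big_ord_recr /= mulrDr IH addnS addSn !big_ord_recr /= -addrA.
by rewrite mulrDl mul1r -exprS mul2n -addnn.
Qed.

Lemma sum_expr_cat r k m :
  \sum_(j < k + m) r ^+ j = \sum_(j < k) r ^+ j + r ^+ k * \sum_(j < m) r ^+ j.
Proof.
by rewrite big_split_ord /= mulr_sumr; congr (_ + _); apply: eq_bigr => j _; rewrite exprD.
Qed.

Lemma sum_expr_ge0 r m : 0 <= r -> 0 <= \sum_(j < m) r ^+ j.
Proof. by move=> r0; apply: sumr_ge0 => j _; rewrite exprn_ge0. Qed.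

(** The middle term is $r^{-(K-\tau)} \sum_{j<2K+2} r^j$. For the lower bound keep $K+2$ consecutive
    terms: the last ones if $\tau = 0$, the first ones if $\tau = K$. For the upper bound factor the
    sum as $(1 + r^{K+1}) \sum_{j \le K} r^j$ and bound each $r^j$ by $r^K$ if $r \ge 1$, by 1 if $r
    \le 1$. *)
Lemma ansatz_weight_bounds r K tau : 0 < r ->
  (tau = 0%N /\ 1 <= r) \/ (tau = K /\ r <= 1) -> (0 < K)%N ->
  \sum_(i < K.+2) r ^+ i
    <= (1 + r) * ((r ^+ (K - tau))^-1 * \sum_(i < K.+1) r ^+ (2 * i))
    <= K.+1%:R * (1 + r ^+ K.+1).
Proof.
move=> r0 htau K0.
rewrite mulrCA geometric_split mulrC.
have upper (m : R) : (forall j : 'I_K.+1, r ^+ j <= m) ->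
    \sum_(j < K.+1 + K.+1) r ^+ j <= K.+1%:R * (1 + r ^+ K.+1) * m.
  move=> h; rewrite sum_expr_cat -{1}[\sum_(j < K.+1) r ^+ j]mul1r -mulrDl.
  rewrite mulrAC [X in _ <= X]mulrC; apply: ler_wpM2l.
    by rewrite addr_ge0 // exprn_ge0 // ltW.
  apply: (@le_trans _ _ (\sum_(j < K.+1) m)); first by apply: ler_sum => j _; exact: h.
  by rewrite sumr_const card_ord mulr_natl.
case: htau => -[-> r1].
  rewrite subn0 ler_pdivlMr ?exprn_gt0 // ler_pdivrMr ?exprn_gt0 //.
  apply/andP; split; last first.
    by apply: upper => j; apply: ler_weXn2l => //; rewrite -ltnS.
  have -> : (K.+1 + K.+1 = K + K.+2)%N by rewrite addSnnS.
  by rewrite sum_expr_cat mulrC lerDr sum_expr_ge0 // ltW.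
rewrite subnn expr0 divr1; apply/andP; split; last first.
  by rewrite -[X in _ <= X]mulr1; apply: upper => j; apply: exprn_ile1 => //; exact: ltW.
have -> : (K.+1 + K.+1 = K.+2 + K)%N by rewrite addSnnS addnC.
by rewrite sum_expr_cat lerDl mulr_ge0 ?exprn_ge0 ?sum_expr_ge0 // ltW.
Qed.

Lemma ratio_cancel (w s h r p : R) : h != 0 -> r != 0 -> p != 0 ->
  w * (s * h) / r / (p * h / r) = w * s / p.
Proof. by move=> h0 r0 p0; field; rewrite h0 r0 p0. Qed.

(** The numerator lies between $mn$ and $(K+1)\,amax$ times $(1+r)\sigma$, and $S$ between
    $(1+r^{K+1})\,mn$ and $amax \sum r^j$. In the quotient the sum cancels from the lower bound and
    $1+r^{K+1}$ from the upper one. One factor $K+1$ comes from the block norms, the other from the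
    bound on $\sigma$. *)
Lemma cond_ratio_bounds (K : nat) r (L0 L1 sigma amax : R) (a : nat -> R) :
  let mn := Num.min (a K.+1) (a 0%N) in
  let S := \sum_(i < K.+2) r ^+ i * a i in
  0 < r -> 0 < mn -> (forall i, (i <= K.+1)%N -> a i <= amax) ->
  (forall i, 0 <= a i) ->
  mn <= L0 <= K.+1%:R * amax -> mn <= L1 <= K.+1%:R * amax ->
  \sum_(i < K.+2) r ^+ i <= (1 + r) * sigma <= K.+1%:R * (1 + r ^+ K.+1) ->
  0 < S /\ (amax / mn)^-1 <= (L0 + r * L1) * sigma / S
    <= K.+1%:R ^+ 2 * (amax / mn).
Proof.
move=> mn S r0 mn0 ha a0 /andP[l0 u0] /andP[l1 u1] /andP[ls us].
have mna i : i = 0%N \/ i = K.+1 -> mn <= a i.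
  by case=> ->; rewrite ge_min lexx ?orbT.
(* Only the two extreme terms of $S$ are kept, since [mn] bounds just [a 0] and [a K.+1] from
   below. *)
have S_low : (1 + r ^+ K.+1) * mn <= S.
  rewrite /S big_ord_recl big_ord_recr /= expr0 mul1r /bump /= add1n mulrDl mul1r.
  set mid := \sum_(i < K) _.
  have mid0 : 0 <= mid by apply: sumr_ge0 => i _; rewrite mulr_ge0 ?exprn_ge0 // ltW.
  apply: lerD; first by apply: mna; left.
  apply: (@le_trans _ _ (r ^+ K.+1 * a K.+1)); last by rewrite lerDr.
  by apply: ler_wpM2l; [rewrite exprn_ge0 // ltW|apply: mna; right].
have Sp : 0 < S.
  by apply: lt_le_trans S_low; rewrite mulr_gt0 // ltr_wpDr // exprn_ge0 // ltW.
have amax0 : 0 < amax.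
  by apply: lt_le_trans mn0 (le_trans (mna 0%N _) (ha _ _)) => //; left.
have S_up : S <= amax * \sum_(i < K.+2) r ^+ i.
  rewrite mulr_sumr; apply: ler_sum => i _; rewrite mulrC.
  by apply: ler_wpM2r; [rewrite exprn_ge0 // ltW|apply: ha; rewrite -ltnS].
have sum0 : 0 <= \sum_(i < K.+2) r ^+ i by exact/sum_expr_ge0/ltW.
have sig0 : 0 <= sigma.
  by rewrite -(pmulr_rge0 _ (_ : 0 < 1 + r)) ?ltr_wpDr // ?(le_trans sum0 ls) // ltW.
have Llow : mn * ((1 + r) * sigma) <= (L0 + r * L1) * sigma.
  rewrite mulrA; apply: ler_wpM2r => //; rewrite mulrDr mulr1 mulrC; apply: lerD => //.
  by rewrite ler_pM2l.
have Lup : (L0 + r * L1) * sigma <= K.+1%:R * amax * ((1 + r) * sigma).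
  rewrite mulrA; apply: ler_wpM2r => //; rewrite mulrDr mulr1 [X in _ <= _ + X]mulrC.
  by apply: lerD => //; rewrite ler_pM2l.
split=> //; apply/andP; split.
  rewrite invf_div ler_pdivlMr // mulrAC ler_pdivrMr //.
  apply: le_trans (ler_wpM2l (ltW mn0) S_up) _.
  rewrite [amax * _]mulrC mulrA ler_pM2r //.
  by apply: le_trans Llow; rewrite ler_pM2l.
rewrite ler_pdivrMr //; apply: le_trans Lup _.
apply: (@le_trans _ _ (K.+1%:R * amax * (K.+1%:R * (1 + r ^+ K.+1)))).
  by apply: ler_wpM2l; rewrite // mulr_ge0 ?ler0n // ltW.
have -> : K.+1%:R * amax * (K.+1%:R * (1 + r ^+ K.+1))
    = K.+1%:R ^+ 2 * (amax / mn) * ((1 + r ^+ K.+1) * mn).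
  by field; rewrite gt_eqF.
by apply: ler_wpM2l => //; rewrite mulr_ge0 ?exprn_ge0 ?divr_ge0 ?ler0n ?ltW.
Qed.

End GeometricSums.

(** * Norms of the pencil coefficients and the bounds on the ratio *)

Section Assembly.
Variables (R : realType) (n K : nat) (A : nat -> 'M[R[i]]_n).
Implicit Types (l delta : R[i]).

Section PencilNorms.
Variables lo hi : R.
Hypotheses (lo_lead : lo <= specnorm (A K.+1)) (lo_const : lo <= specnorm (A 0%N))
  (le_hi : forall i, (i <= K.+1)%N -> specnorm (A i) <= hi).

Let hi_ge0 : 0 <= hi.
Proof. by apply: le_trans (le_hi (leq0n _)); exact: specnorm_ge0. Qed.

Let le_hi0 : @specnorm R n 0 <= hi.
Proof. by rewrite (eqP (_ : specnorm 0 == 0)) ?hi_ge0 // specnorm_eq0. Qed.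

Let le_hiN i : (i <= K.+1)%N -> specnorm (- A i) <= hi.
Proof. by rewrite specnormN; exact: le_hi. Qed.

Lemma block_matrix_norm_le (F : nat -> nat -> 'M[R[i]]_n) :
  (forall i j, (0 < i <= K.+1)%N -> (0 < j <= K.+1)%N ->
    specnorm (F i j) <= hi) ->
  specnorm (block_matrix K.+1 F) <= K.+1%:R * hi.
Proof.
move=> h; apply: (specnorm_bmx_le (F := fun i j => F i.+1 j.+1) hi_ge0).
by move=> i j; apply: h; rewrite /= ltn_ord.
Qed.

Lemma block_matrix_norm_ge (F : nat -> nat -> 'M[R[i]]_n) i j :
  (0 < i <= K.+1)%N -> (0 < j <= K.+1)%N -> lo <= specnorm (F i j) ->
  lo <= specnorm (block_matrix K.+1 F).
Proof.
case: i j => [|i] [|j] //= iK jK h; apply: le_trans h _.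
exact: (specnorm_block_le (fun i j => F i.+1 j.+1) (Ordinal iK) (Ordinal jK)).
Qed.

Let within_first : (0 < 1 <= K.+1)%N. Proof. by []. Qed.
Let within_last : (0 < K.+1 <= K.+1)%N. Proof. by rewrite leqnn. Qed.

(** In this and the next three lemmas every block is zero or some $\pm A_i$, whence the upper bound;
    the lower bound comes from exhibiting one block equal to $\pm A_k$ or $\pm A_0$. *)
Lemma D1_L1_norm : lo <= specnorm (D1_L1 K.+1 A) <= K.+1%:R * hi.
Proof.
apply/andP; split.
  exact: (block_matrix_norm_ge within_first within_first lo_lead).
apply: block_matrix_norm_le => i j /andP[i0 iK] /andP[j0 jK].
case: ifP => h1; first exact: le_hi.
case: ifP => h2; first exact: le_hi0.
by case: ifP => h3; [apply: le_hiN; lia|exact: le_hi0].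
Qed.

Lemma D1_L0_norm : lo <= specnorm (D1_L0 K.+1 A) <= K.+1%:R * hi.
Proof.
apply/andP; split.
  apply: (block_matrix_norm_ge within_first within_last).
  have -> : (1 + K.+1 <= K.+1 + 1)%N by lia.
  have -> : (K.+1 + 1 - 1 - K.+1 = 0)%N by lia.
  by rewrite specnormN; exact: lo_const.
apply: block_matrix_norm_le => i j /andP[i0 iK] /andP[j0 jK].
by case: ifP => h3; [apply: le_hiN; lia|exact: le_hi0].
Qed.

Lemma Dk_L1_norm : lo <= specnorm (Dk_L1 K.+1 A) <= K.+1%:R * hi.
Proof.
apply/andP; split.
  apply: (block_matrix_norm_ge within_first within_last).
  have -> : (K.+1 + 1 <= 1 + K.+1)%N by lia.
  have -> : (2 * K.+1 + 1 - 1 - K.+1 = K.+1)%N by lia.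
  exact: lo_lead.
apply: block_matrix_norm_le => i j /andP[i0 iK] /andP[j0 jK].
by case: ifP => h3; [apply: le_hi; lia|exact: le_hi0].
Qed.

Lemma Dk_L0_norm : lo <= specnorm (Dk_L0 K.+1 A) <= K.+1%:R * hi.
Proof.
apply/andP; split.
  apply: (block_matrix_norm_ge within_last within_last).
  by rewrite eqxx specnormN; exact: lo_const.
apply: block_matrix_norm_le => i j /andP[i0 iK] /andP[j0 jK].
case: ifP => h1; first exact: le_hiN.
case: ifP => h2; first exact: le_hi0.
by case: ifP => h3; [apply: le_hi; lia|exact: le_hi0].
Qed.

End PencilNorms.

Let hi : R := \big[Num.max/0]_(i < K.+2) specnorm (A i).
Let lo : R := Num.min (specnorm (A K.+1)) (specnorm (A 0%N)).

Let le_hi i : (i <= K.+1)%N -> specnorm (A i) <= hi.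
Proof.
move=> iK; have iK' : (i < K.+2)%N by [].
exact: (le_bigmax _ (fun i : 'I_K.+2 => specnorm (A i)) (Ordinal iK')).
Qed.

Let lo_le : lo <= specnorm (A K.+1) /\ lo <= specnorm (A 0%N).
Proof. by apply/andP; rewrite -le_min. Qed.

Let normDL (L : R) := lo <= L <= K.+1%:R * hi.

Lemma D1_norms : normDL (specnorm (D1 K.+1 A 0%N)) /\ normDL (specnorm (D1 K.+1 A 1%N)).
Proof.
have [lK l0] := lo_le; rewrite /D1 /pencil eqxx specnormN; split.
- exact: D1_L0_norm lK l0 le_hi.
- exact: D1_L1_norm lK l0 le_hi.
Qed.

Lemma Dk_norms : normDL (specnorm (Dk K.+1 A 0%N)) /\ normDL (specnorm (Dk K.+1 A 1%N)).
Proof.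
have [lK l0] := lo_le; rewrite /Dk /pencil eqxx specnormN; split.
- exact: Dk_L0_norm lK l0 le_hi.
- exact: Dk_L1_norm lK l0 le_hi.
Qed.

Lemma pencil_block_cont F1 F0 delta (i j : 'I_K.+1) :
  mcont (fun l => @pencil_block R n K F1 F0 l i j) delta.
Proof.
move=> a b.
have -> : (fun l => pencil_block F1 F0 l i j a b)
  = (fun l => l * F1 i.+1 j.+1 a b + - F0 i.+1 j.+1 a b).
  by apply/funext => l; rewrite !mxE.
apply: ccontD; last exact: ccont_cst.
by apply: ccontM; [exact: ccont_id|exact: ccont_cst].
Qed.

Lemma wsum_pencil (L : nat -> 'M[R[i]]_(\sum_(i < K.+1) n)) delta :
  wsum 1 L delta = specnorm (L 0%N) + normc delta * specnorm (L 1%N).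
Proof. by rewrite /wsum [LHS]big_ord_recl [X in _ + X]big_ord1 /= expr0 mul1r expr1. Qed.

(** Both condition numbers are given by [cond_number_resolvent]. Since the resolvent of the pencil
    has norm $\sigma \|H_P(\delta)\|$, the factors $\|H_P(\delta)\|$ and $|\delta|$ cancel in the
    ratio, which leaves the quotient of the two weights times $\sigma$. *)
Lemma ansatz_cond_bounds (tau : 'I_K.+1) (L : nat -> 'M[R[i]]_(\sum_(i < K.+1) n))
    (Dl : R[i] -> 'I_K.+1 -> 'I_K.+1 -> 'M[R[i]]_n) delta x z :
  (0 < K)%N -> A K.+1 != 0 -> A 0%N != 0 -> regular_mxpoly K.+1 A ->
  simple_eigenvalue K.+1 A delta -> delta != 0 ->
  right_eigenvector K.+1 A delta x -> right_eigenvector 1 L delta z ->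
  (forall l, mxeval 1 L l = bmx (Dl l)) ->
  (forall l i j, Dl l i j = Dl l j i) ->
  (forall i j, mcont (fun l => Dl l i j) delta) ->
  (forall l i, \sum_(j < K.+1) l ^+ (K - j) *: Dl l i j
    = if i == tau then mxeval K.+1 A l else 0) ->
  (forall l (v : 'I_K.+1 -> 'cV[R[i]]_n), v ord_max = 0 ->
    (forall i, i != tau -> \sum_j Dl l i j *m v j = 0) -> forall j, v j = 0) ->
  normDL (specnorm (L 0%N)) /\ normDL (specnorm (L 1%N)) ->
  (tau = 0%N :> nat /\ 1 <= normc delta) \/ (tau = K :> nat /\ normc delta <= 1) ->
  ((rho K.+1 A)^-1%:E <= cond_number 1 L delta z / cond_number K.+1 A delta x
   <= (K.+1%:R ^+ 2 * rho K.+1 A)%:E)%E.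
Proof.
move=> K0 AK0 A00 reg simp d0 hx [z0 hz] evL sym cont ans inj [nL0 nL1] htau.
have [ker [HP [cHP PHP rgHP HPP HP0]]] := simple_eigenvalue_resolvent reg simp hx.
(* The pencil is block symmetric, so the left ansatz identity follows from the right one. *)
have ans' l j : \sum_(i < K.+1) l ^+ (K - i) *: Dl l i j
    = if j == tau then mxeval K.+1 A l else 0.
  by rewrite -ans; apply: eq_bigr => i _; rewrite sym.
have nd0 : 0 < normc delta by rewrite normc_gt0.
have lo0 : 0 < lo by rewrite lt_min; apply/andP; split; rewrite specnorm_gt0.
have sp := ansatz_weight_bounds nd0 htau K0.
have [] := cond_ratio_bounds nd0 lo0 le_hi (fun i => specnorm_ge0 (A i)) nL0 nL1 sp.
rewrite -/(wsum K.+1 A delta) => SP bnd.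
have h0 : 0 < specnorm (HP delta) by rewrite specnorm_gt0.
have kP : cond_number K.+1 A delta x
    = (wsum K.+1 A delta * specnorm (HP delta) / normc delta)%:E.
  by apply: cond_number_resolvent => //; case: hx.
pose HD := ansatz_resolvent tau Dl delta HP.
have sHD := specnorm_ansatz_resolvent ans' inj d0 HPP.
have sig0 : 0 < (normc delta ^+ (K - tau))^-1 * \sum_(i < K.+1) normc delta ^+ (2 * i).
  rewrite mulr_gt0 ?invr_gt0 ?exprn_gt0 // big_ord_recl expr0 ltr_wpDr //.
  by apply: sumr_ge0 => i _; rewrite exprn_ge0 // ltW.
have kD : cond_number 1 L delta z
    = (wsum 1 L delta * specnorm (HD delta) / normc delta)%:E.
  apply: (cond_number_resolvent (H := HD)) => //.
  - exact (ansatz_resolvent_cont inj cont cHP).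
  - near=> l; rewrite evL; near: l; exact (ansatz_resolventP ans inj PHP).
  - by rewrite evL in hz; exact (ansatz_resolvent_spec ans ans' inj d0 HPP ker rgHP z0 hz).
  - by rewrite -specnorm_gt0 sHD mulr_gt0.
  - rewrite wsum_pencil ltr_wpDr ?mulr_ge0 ?specnorm_ge0 ?normc_ge0 //.
    by apply: lt_le_trans lo0 _; case/andP: nL0.
have -> : (cond_number 1 L delta z / cond_number K.+1 A delta x
  = ((specnorm (L 0%N) + normc delta * specnorm (L 1%N))
     * ((normc delta ^+ (K - tau))^-1 * \sum_(i < K.+1) normc delta ^+ (2 * i))
     / wsum K.+1 A delta)%:E)%E.
  (* Inversion in [\bar R] is the real one here because the denominator is nonzero. *)
  rewrite kP kD inver ifF; last first.
    by apply/negbTE; rewrite !mulf_neq0 ?invr_eq0 ?gt_eqF.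
  rewrite -EFinM wsum_pencil sHD; congr EFin.
  exact: (ratio_cancel _ _ (lt0r_neq0 h0) (lt0r_neq0 nd0) (lt0r_neq0 SP)).
by rewrite !lee_fin.
Unshelve. all: by end_near. Qed.

End Assembly.

Theorem theorem6p3 (R : realType) (n k t : nat) (A : nat -> 'M[R[i]]_n)
    (delta : R[i]) (x : 'cV[R[i]]_n) (z : 'cV[R[i]]_(\sum_(i < k) n))
    (hk : (2 <= k)%N)
    (hAk : A k != 0)
    (hreg : regular_mxpoly k A)
    (hA0 : A 0%N != 0)
    (hsimple : simple_eigenvalue k A delta)
    (hdelta : delta != 0)
    (hx : right_eigenvector k A delta x)
    (hz : right_eigenvector 1 (D k t A) delta z)
    (ht : t = 1%N \/ t = k)
    (ht1 : t = 1%N -> A 0%N \in unitmx)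
    (htk : t = k -> A k \in unitmx)
    (hmod : (t = 1%N /\ 1 <= Normc.normc delta)
            \/ (t = k /\ Normc.normc delta <= 1)) :
  ((rho k A)^-1%:E <= cond_number 1 (D k t A) delta z / cond_number k A delta x
   <= (k%:R ^+ 2 * rho k A)%:E)%E.
Proof.
case: k hk => // K hK in z hAk hreg hsimple hx hz ht htk hmod *.
have K0 : (0 < K)%N by [].
case: hmod => -[tE nd].
- have DE : D K.+1 t A = D1 K.+1 A by rewrite /D tE.
  rewrite DE in hz *.
  apply: (ansatz_cond_bounds (tau := ord0) K0 hAk hA0 hreg hsimple hdelta hx hz
    (mxeval_D1 K A)) => //.
  + exact: D1_block_sym.
  + by move=> i j; exact: pencil_block_cont.
  + exact: D1_ansatz.
  + by move=> l v; apply: D1_trunc_inj; exact: ht1.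
  + exact: D1_norms.
  + by left.
(* The test [t == 1] in [D] fails for $t = k$ because $k \ge 2$. *)
- have DE : D K.+1 t A = Dk K.+1 A by rewrite /D tE eqSS gtn_eqF.
  rewrite DE in hz *.
  apply: (ansatz_cond_bounds (tau := ord_max) K0 hAk hA0 hreg hsimple hdelta hx hz
    (mxeval_Dk K A)) => //.
  + exact: Dk_block_sym.
  + by move=> i j; exact: pencil_block_cont.
  + exact: Dk_ansatz.
  + by move=> l v; apply: Dk_trunc_inj; exact: htk.
  + exact: Dk_norms.
  + by right.
Qed.
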